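(* Let $\lambda,\mu,\nu$ be any (finite) line partitions in the $(x_2,x_3)$-, $(x_1,x_3)$-, $(x_1,x_2)$-planes respectively, viewed as plane partitions in $(x_2,x_3,x_4)$-, $(x_1,x_3,x_4)$-, $(x_1,x_2,x_4)$-space via $\{x_4=0\}\subseteq\mathbb C^4$. For every $\pi\in\Pi^{\mathrm{DT}}(\lambda,\mu,\nu,\varnothing)$ choose its sign in $\mathsf V^{\mathrm{DT}}_{\lambda\mu\nu\varnothing}$ equal to $(-1)^{|\pi_{\mathrm{CM}}(\lambda,\mu,\nu,\varnothing)|+c}$, where $c$ is the number of boxes of $\pi$ not in $\pi_{\mathrm{CM}}(\lambda,\mu,\nu,\varnothing)$ (the number of embedded points). For every $B\in\Pi^{\mathrm{PT}}(\lambda,\mu,\varnothing,\varnothing)$ choose its sign in $\mathsf V^{\mathrm{PT}}_{\lambda\mu\varnothing\varnothing}$ equal to $(-1)^{|\pi_{\mathrm{CM}}(\lambda,\mu,\varnothing,\varnothing)|+|B|}$. Then $$\mathsf V^{\mathrm{DT}}_{\lambda\mu\nu\varnothing}(t,y,q)|_{y=t_4}=\mathsf V^{3\mathrm D,\mathrm{DT}}_{\lambda\mu\nu}(t,-q),\qquad \mathsf V^{\mathrm{PT}}_{\lambda\mu\varnothing\varnothing}(t,y,q)|_{y=t_4}=\mathsf V^{3\mathrm D,\mathrm{PT}}_{\lambda\mu\varnothing}(t,-q).$$ In particular, assume the $K$-theoretic DT/PT vertex correspondence: for any finite plane partitions $\lambda',\mu',\nu',\rho'$, at most two non-empty, there are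 choices of signs such that $\mathsf V^{\mathrm{DT}}_{\lambda'\mu'\nu'\rho'}=\mathsf V^{\mathrm{PT}}_{\lambda'\mu'\nu'\rho'}\,\mathsf V^{\mathrm{DT}}_{\varnothing\varnothing\varnothing\varnothing}$, and, when the signs for $\mathsf V^{\mathrm{DT}}_{\varnothing\varnothing\varnothing\varnothing}$ are the unique signs for which $\mathsf V^{\mathrm{DT}}_{\varnothing\varnothing\varnothing\varnothing}=\mathrm{Exp}\Big(\frac{[t_1t_2][t_1t_3][t_2t_3][y]}{[t_1][t_2][t_3][t_4][y^{1/2}q][y^{1/2}q^{-1}]}\Big)$, at each order in $q$ the choice of signs for which both sides agree is unique up to an overall sign. Assume also compatibility of signs: the signs realizing this correspondence can be chosen so that for all $\pi$ and $B$ scheme-theoretically supported on $\{x_4=0\}$ they agree with the signs specified above. Then $$\mathsf V^{3\mathrm D,\mathrm{DT}}_{\lambda\mu\varnothing}(t,q)=\mathsf V^{3\mathrm D,\mathrm{PT}}_{\lambda\mu\varnothing}(t,q)\,\mathsf V^{3\mathrm D,\mathrm{DT}}_{\varnothing\varnothing\varnothing}(t,q).$$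
   Context: **Partitions.** A plane partition $\lambda=\{\lambda_{ij}\}_{i,j\ge1}$ has entries in $\mathbb Z_{\ge0}$, non-increasing in $i$ and $j$; it is finite if $|\lambda|=\sum\lambda_{ij}<\infty$. A solid partition $\pi=\{\pi_{ijk}\}_{i,j,k\ge1}$ has entries in $\mathbb Z_{\ge0}\cup\{\infty\}$, non-increasing in each index, and is identified with its set of boxes $\{(i,j,k,l)\in\mathbb Z_{\ge1}^4: l\le\pi_{ijk}\}$. For finite plane partitions $\lambda,\mu,\nu,\rho$ the four legs are $\{l\le\lambda_{jk}\}$, $\{l\le\mu_{ik}\}$, $\{l\le\nu_{ij}\}$, $\{k\le\rho_{ij}\}$ in $\mathbb Z_{\ge1}^4$ (legs along axes 1,2,3,4). $\pi_{\mathrm{CM}}(\lambda,\mu,\nu,\rho)$ is the union of the legs; $\Pi^{\mathrm{DT}}(\lambda,\mu,\nu,\rho)$ is the set of solid partitions containing $\pi_{\mathrm{CM}}$ with finite complement. (These correspond to the $T$-fixed subschemes $Z\subset\mathbb C^4$ whose maximal Cohen-Macaulay subcurve is given by $\pi_{\mathrm{CM}}$.) Renormalized volume: $|\pi|=\sum_{w\in\pi}(1-\#\{\text{legs containing }w\})$. Leg characters: $Z_1=\sum_{l\le\lambda_{jk}}t_2^{j-1}t_3^{k-1}t_4^{l-1}$, $Z_2=\sum_{l\le\mu_{ik}}t_1^{i-1}t_3^{k-1}t_4^{l-1}$, $Z_3=\sum_{l\le\nu_{ij}}t_1^{i-1}t_2^{j-1}t_4^{l-1}$, $Z_4=\sum_{k\le\rho_{ij}}t_1^{i-1}t_2^{j-1}t_3^{k-1}$.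 For $\pi\in\Pi^{\mathrm{DT}}$: $Z_\pi=\sum_{(i,j,k,l)\in\pi}t_1^{i-1}t_2^{j-1}t_3^{k-1}t_4^{l-1}$, viewed as a rational function. If at most two of $\lambda,\mu,\nu,\rho$ are non-empty: the extended leg $\mathrm{Leg}_i\subset\mathbb Z^4$ is the set of weights obtained from the boxes of the $i$-th leg by subtracting $(1,1,1,1)$ and letting the $i$-th coordinate be an arbitrary integer. $\mathrm{II}$ is the set of weights in exactly two legs; $\mathrm I^-$ the set of weights in $\bigcup_i\mathrm{Leg}_i$ with some negative coordinate. $\Pi^{\mathrm{PT}}(\lambda,\mu,\nu,\rho)$ is the set of box configurations: finite $B\subset\mathrm{II}\cup\mathrm I^-$ such that $w\in\mathrm{II}\cup\mathrm I^-$ and $w-e_j\in B$ for some $j$ imply $w\in B$ ($T$-fixed stable pairs on $\mathbb C^4$ with support curve $\pi_{\mathrm{CM}}$ and cokernel of length $|B|=\#B$). Put $Z_B=Z_{\pi_{\mathrm{CM}}(\lambda,\mu,\nu,\rho)}+\sum_{w\in B}t^w$. **4-fold vertex.** $\overline{(\cdot)}$ is $t_i\mapsto t_i^{-1}$. For $Z=Z_\pi$ or $Z_B$, with $P_{123}=(1-t_1)(1-t_2)(1-t_3)$, $$\widetilde{\mathsf v}=Z-y\overline Z-\overline P_{123}Z\overline Z+\sum_{i=1}^3\frac{\widetilde{\mathsf f}_i}{1-t_i}+\frac1{1-t_4}\Big\{-Z_4-t_4y\overline Z_4+\overline P_{123}(\overline ZZ_4-Z\overline Z_4)+\frac{\overline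 P_{123}}{1-t_4}Z_4\overline Z_4\Big\},$$ $\widetilde{\mathsf f}_i=-Z_i-t_iy\overline Z_i+\frac{(1-t_a)(1-t_b)}{t_at_b}Z_i\overline Z_i$ with $\{a,b\}=\{1,2,3\}\setminus\{i\}$. This is a Laurent polynomial; then $t_1t_2t_3t_4=1$ is imposed (with square roots satisfying $t_1^{1/2}t_2^{1/2}t_3^{1/2}t_4^{1/2}=1$). Bracket: $[x]=x^{1/2}-x^{-1/2}$ for a monomial $x$ and $[\sum_a\tau^a-\sum_b\tau^b]=\prod_a[\tau^a]/\prod_b[\tau^b]$. Define $$\mathsf V^{\mathrm{DT}}_{\lambda\mu\nu\rho}=\sum_{\pi\in\Pi^{\mathrm{DT}}}(\pm1)[-\widetilde{\mathsf v}_\pi]q^{|\pi|},\qquad \mathsf V^{\mathrm{PT}}_{\lambda\mu\nu\rho}=\sum_{B\in\Pi^{\mathrm{PT}}}(\pm1)[-\widetilde{\mathsf v}_B]q^{|B|+|\pi_{\mathrm{CM}}(\lambda,\mu,\nu,\rho)|},$$ depending on a choice of sign for each $\pi$, $B$. $\mathrm{Exp}(f)=\exp\big(\sum_{n\ge1}\frac1n f|_{\text{all variables}\mapsto n\text{-th powers}}\big)$; its argument above is expanded as a power series in $q$. **3-fold vertex.** A line partition is viewed as a plane partition all of whose entries are $\le1$ (boxes with $x_4$-coordinate $l=1$). A solid partition is scheme-theoretically supported on $\{x_4=0\}$ if all its boxes have $l=1$ (i.e. it is a 3D partition); for $B$ one requires all boxes of $\pi_{\mathrm{CM}}$ to have $l=1$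 and all weights in $B$ to have fourth coordinate $0$. For $Z=Z_\pi$ or $Z_B$ with such support (so $Z,Z_1,Z_2,Z_3$ do not involve $t_4$), put $$\mathsf V^{3\mathrm D}=Z-\frac{\overline Z}{t_1t_2t_3}+\frac{(1-t_1)(1-t_2)(1-t_3)}{t_1t_2t_3}Z\overline Z+\sum_{i=1}^3\frac1{1-t_i}\Big(-Z_i-\frac{\overline Z_i}{t_at_b}+\frac{(1-t_a)(1-t_b)}{t_at_b}Z_i\overline Z_i\Big),\quad\{a,b\}=\{1,2,3\}\setminus\{i\},$$ a Laurent polynomial in $t_1,t_2,t_3$. For line partitions, $\mathsf V^{3\mathrm D,\mathrm{DT}}_{\lambda\mu\nu}(t,q)=\sum_\pi[-\mathsf V^{3\mathrm D}_\pi]q^{|\pi|}$ over $\pi\in\Pi^{\mathrm{DT}}(\lambda,\mu,\nu,\varnothing)$ with all boxes having $l=1$, and $\mathsf V^{3\mathrm D,\mathrm{PT}}_{\lambda\mu\varnothing}(t,q)=\sum_{B\in\Pi^{\mathrm{PT}}(\lambda,\mu,\varnothing,\varnothing)}[-\mathsf V^{3\mathrm D}_B]q^{|B|+|\pi_{\mathrm{CM}}(\lambda,\mu,\varnothing,\varnothing)|}$, in $\mathbb Q(t_1,t_2,t_3,(t_1t_2t_3)^{1/2})(\!(q)\!)$. At $y=t_4=(t_1t_2t_3)^{-1}$ one takes $y^{1/2}=t_4^{1/2}=(t_1t_2t_3)^{-1/2}$. *)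

(* Defs.v *)
From HB Require Import structures.
From mathcomp Require Import all_boot all_order all_algebra finmap.
From mathcomp Require Import boolp classical_sets functions cardinality fsbigop.
From mathcomp Require Import mpoly.

Set Implicit Arguments.
Unset Strict Implicit.
Unset Printing Implicit Defensive.

Import Order.TTheory GRing.Theory Num.Theory.

Local Open Scope classical_set_scope.
Local Open Scope ring_scope.

(* Indices are 0-based throughout: a box (i,j,k,l) of Z_{>=1}^4 is recorded by
   its weight (i-1,j-1,k-1,l-1), and the axes 1,2,3,4 are the elements
   0,1,2,3 (= ord_max) of 'I_4.  Infinite sums indexed by a set are the
   finitely supported sums \sum_(x \in A) of fsbigop. *)

Section Partitions.

Definition pfun := nat -> nat -> nat.

Definition is_plane_partition (p : pfun) : Prop :=
  [/\ forall i j, (p i.+1 j <= p i j)%N,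
      forall i j, (p i j.+1 <= p i j)%N &
      finite_set [set ij : nat * nat | p ij.1 ij.2 != 0%N]].

Definition is_line_partition (p : pfun) : Prop :=
  is_plane_partition p /\ forall i j, (p i j <= 1)%N.

Definition empty_pp : pfun := fun _ _ => 0%N.

Definition quad (lam mu nu rho : pfun) : 'I_4 -> pfun :=
  fun a => nth empty_pp [:: lam; mu; nu; rho] a.

Definition empty4 : 'I_4 -> pfun := fun _ => empty_pp.

Definition four_plane_partitions (P : 'I_4 -> pfun) : Prop :=
  forall a, is_plane_partition (P a).

Definition at_most_two_nonempty (P : 'I_4 -> pfun) : Prop :=
  (#|[pred a | P a != empty_pp]| <= 2)%N.

Definition weight := 'rV[int]_4.

Definition e_ (j : 'I_4) : weight := delta_mx 0 j.

(* Entries of a solid partition lie in nat together with infinity = None. *)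
Definition solid := nat -> nat -> nat -> option nat.

Definition le_inf (m n : option nat) : bool :=
  match m, n with
  | _, None => true
  | None, Some _ => false
  | Some m', Some n' => (m' <= n')%N
  end.

Definition is_solid_partition (p : solid) : Prop :=
  forall i j k, [/\ le_inf (p i.+1 j k) (p i j k),
                    le_inf (p i j.+1 k) (p i j k) &
                    le_inf (p i j k.+1) (p i j k)].

Definition boxes (p : solid) : set weight :=
  [set w | exists i j k l : nat,
    [/\ w = \row_(a < 4) (nth 0%N [:: i; j; k; l] a)%:Z &
        le_inf (Some l.+1) (p i j k)]].

(* The three coordinates of w other than the a-th one, in increasing order, are
   w 0 (lift a 0), w 0 (lift a 1), w 0 (lift a 2).  For a = 0,1,2,3 the
   condition below reads l <= lam_jk, l <= mu_ik, l <= nu_ij, k <= rho_ij in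
   1-based indices. *)
Definition ext_leg (P : 'I_4 -> pfun) (a : 'I_4) : set weight :=
  [set w | exists x y z : nat,
    [/\ w 0 (lift a (0 : 'I_3)) = x%:Z, w 0 (lift a (1 : 'I_3)) = y%:Z,
        w 0 (lift a (2 : 'I_3)) = z%:Z & (z < P a x y)%N]].

Definition leg (P : 'I_4 -> pfun) (a : 'I_4) : set weight :=
  [set w | ext_leg P a w /\ 0 <= w 0 a].

Definition nlegs (P : 'I_4 -> pfun) (w : weight) : nat :=
  #|[pred a | `[< leg P a w >]]|.

Definition pi_CM (P : 'I_4 -> pfun) : set weight :=
  [set w | exists a, leg P a w].

Definition Pi_DT (P : 'I_4 -> pfun) : set solid :=
  [set p | [/\ is_solid_partition p, pi_CM P `<=` boxes p &
               finite_set (boxes p `\` pi_CM P)]].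

Definition renorm_vol (P : 'I_4 -> pfun) (S : set weight) : int :=
  \sum_(w \in S) (1 - (nlegs P w)%:Z).

Definition vol_DT (P : 'I_4 -> pfun) (p : solid) : int :=
  renorm_vol P (boxes p).

Definition nembedded (P : 'I_4 -> pfun) (p : solid) : nat :=
  #|` fset_set (boxes p `\` pi_CM P)|.

Definition II_ (P : 'I_4 -> pfun) : set weight := [set w | nlegs P w = 2%N].

Definition I_minus (P : 'I_4 -> pfun) : set weight :=
  [set w | (exists a, ext_leg P a w) /\ exists a, w 0 a < 0].

Definition Pi_PT (P : 'I_4 -> pfun) : set {fset weight} :=
  [set B | (forall w, w \in B -> (II_ P `|` I_minus P) w) /\
           (forall w j, (II_ P `|` I_minus P) w -> w - e_ j \in B -> w \in B)].

Definition vol_PT (P : 'I_4 -> pfun) (B : {fset weight}) : int :=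
  #|` B|%:Z + renorm_vol P (pi_CM P).

(* All boxes have l = 1, i.e. vanishing fourth (0-based) coordinate. *)
Definition in_x4_zero (S : set weight) : Prop :=
  forall w, S w -> w 0 ord_max = 0.

Definition supported_DT (p : solid) : Prop := in_x4_zero (boxes p).

Definition supported_PT (P : 'I_4 -> pfun) (B : {fset weight}) : Prop :=
  in_x4_zero (pi_CM P) /\ in_x4_zero [set w | w \in B].

End Partitions.

Section RationalFunctions.

(* Q(x_0, ..., x_{n-1}), as the field of fractions of Z[x_0, ..., x_{n-1}]. *)
Definition ratfun (n : nat) : fieldType := {fraction {mpoly int[n]}}.

Definition rvar (n : nat) (i : 'I_n) : ratfun n :=
  @FracField.tofrac {mpoly int[n]} 'X_i.

Definition mpeval (n : nat) (F : fieldType) (h : 'I_n -> F)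
  (p : {mpoly int[n]}) : F := mmap intr h p.

(* Substitution x_i |-> h i, for algebraically independent h i. *)
Definition ratsubst (n : nat) (F : fieldType) (h : 'I_n -> F) (f : ratfun n)
  : F :=
  mpeval h (repr (f : {fraction {mpoly int[n]}})).1 /
  mpeval h (repr (f : {fraction {mpoly int[n]}})).2.

(* f is regular at the point h, with value v. *)
Definition specializes (n : nat) (F : fieldType) (h : 'I_n -> F)
  (f : ratfun n) (v : F) : Prop :=
  exists p q : {mpoly int[n]},
    [/\ mpeval h q != 0,
        f = FracField.tofrac p / FracField.tofrac q &
        v = mpeval h p / mpeval h q].

Definition mono (n : nat) (F : fieldType) (x : 'I_n -> F) (m : 'rV[int]_n) : F :=
  \prod_(i < n) x i ^ m 0 i.

(* Laurent polynomials over Z in n variables: coefficients by exponent. *)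
Definition laurent (n : nat) := {fsfun 'rV[int]_n -> int with 0}.

Definition laurent_eval (n : nat) (L : laurent n) : ratfun n :=
  \sum_(m <- finsupp L) (L m)%:~R * mono (@rvar n) m.

(* The unique L with laurent_eval L = f when f is a Laurent polynomial, the zero
   Laurent polynomial otherwise. *)
Definition laurent_of (n : nat) (f : ratfun n) : laurent n :=
  xget ([fsfun] : laurent n) [set L | laurent_eval L = f].

(* Monomial substitution, acting on exponents by h; like terms are collected. *)
Definition push (n k : nat) (h : 'rV[int]_n -> 'rV[int]_k) (L : laurent n)
  : laurent k :=
  [fsfun m in [fset h m' | m' in finsupp L]%fset =>
     \sum_(m' <- finsupp L | h m' == m) L m' | 0].

(* [x] = x^(1/2) - x^(-1/2) as a function of r = x^(1/2). *)
Definition br (F : fieldType) (r : F) : F := r - r^-1.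

(* The bracket of a Laurent polynomial L in variables whose square roots are the
   variables of ratfun n: the monomial with exponent m has square root
   mono (@rvar n) m. *)
Definition bracket (n : nat) (L : laurent n) : ratfun n :=
  \prod_(m <- finsupp L) br (mono (@rvar n) m) ^ L m.

End RationalFunctions.

Section Characters.

Variables (F : fieldType) (t : 'I_4 -> F).

(* Coefficient of t^w in prod_i (1 - t_i) * sum_(w in S) t^w. *)
Definition numer_coef (S : set weight) (w : weight) : int :=
  \sum_(A : {set 'I_4})
    (-1) ^+ #|A| * (`[< S (w - \sum_(i in A) e_ i) >] : nat)%:Z.

(* sum_(w in S) t^w viewed as a rational function and evaluated at t; used for
   finite unions of legs and finite sets, whose numerators are finite. *)
Definition gen_fun (S : set weight) : F :=
  (\sum_(w \in [set: weight]) (numer_coef S w)%:~R * mono t w) /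
  \prod_(i < 4) (1 - t i).

(* Z_1, ..., Z_4: the boxes of the section of the a-th leg are the weights of
   the leg with vanishing a-th coordinate. *)
Definition Z_leg (P : 'I_4 -> pfun) (a : 'I_4) : F :=
  \sum_(w \in [set w | leg P a w /\ w 0 a = 0]) mono t w.

Definition Z_DT (p : solid) : F := gen_fun (boxes p).

Definition Z_PT (P : 'I_4 -> pfun) (B : {fset weight}) : F :=
  gen_fun (pi_CM P) + \sum_(w <- B) mono t w.

End Characters.

Section Vertices.

(* In ratfun 5 the variables are t_1, t_2, t_3, t_4, y. *)
Definition tix (a : 'I_4) : 'I_5 := lift ord_max a.
Definition tvar (a : 'I_4) : ratfun 5 := rvar (tix a).
Definition tinv (a : 'I_4) : ratfun 5 := (tvar a)^-1.
Definition yvar : ratfun 5 := rvar (ord_max : 'I_5).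

(* A character is given as a function of the point t, so that its conjugate
   under t_i |-> t_i^-1 is its value at tinv.  The axes i in {1,2,3} are those
   with i != ord_max. *)
Definition v_tilde (P : 'I_4 -> pfun) (chi : ('I_4 -> ratfun 5) -> ratfun 5)
  : ratfun 5 :=
  let t := tvar in
  let y := yvar in
  let Z := chi tvar in
  let Zb := chi tinv in
  let Zl := Z_leg tvar P in
  let Zlb := Z_leg tinv P in
  let P123b := \prod_(i < 4 | i != ord_max) (1 - tinv i) in
  let f i :=
    - Zl i - t i * y * Zlb i
    + (\prod_(a < 4 | (a != ord_max) && (a != i)) ((1 - t a) / t a))
      * Zl i * Zlb i in
  let t4 := t ord_max in
  let Z4 := Zl ord_max in
  let Z4b := Zlb ord_max in
  Z - y * Zb - P123b * Z * Zb
  + \sum_(i < 4 | i != ord_max) f i / (1 - t i)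
  + (1 - t4)^-1 *
    (- Z4 - t4 * y * Z4b + P123b * (Zb * Z4 - Z * Z4b)
     + P123b / (1 - t4) * Z4 * Z4b).

Definition V3D (P : 'I_4 -> pfun) (chi : ('I_4 -> ratfun 5) -> ratfun 5)
  : ratfun 5 :=
  let t := tvar in
  let Z := chi tvar in
  let Zb := chi tinv in
  let Zl := Z_leg tvar P in
  let Zlb := Z_leg tinv P in
  let t123 := \prod_(i < 4 | i != ord_max) t i in
  Z - Zb / t123
  + (\prod_(i < 4 | i != ord_max) (1 - t i)) / t123 * Z * Zb
  + \sum_(i < 4 | i != ord_max) (1 - t i)^-1 *
      (- Zl i
       - Zlb i / \prod_(a < 4 | (a != ord_max) && (a != i)) t a
       + (\prod_(a < 4 | (a != ord_max) && (a != i)) ((1 - t a) / t a))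
         * Zl i * Zlb i).

(* Imposing t_1 t_2 t_3 t_4 = 1: exponents in (t_1,t_2,t_3,t_4,y) become
   exponents in (t_1,t_2,t_3,y). *)
Definition cy_exp (m : 'rV[int]_5) : 'rV[int]_4 :=
  \row_(j < 4) if unlift ord_max j is Some i
               then m 0 (tix (lift ord_max i)) - m 0 (tix ord_max)
               else m 0 ord_max.

(* Exponents in (t_1,t_2,t_3), for Laurent polynomials in these only. *)
Definition exp3 (m : 'rV[int]_5) : 'rV[int]_3 :=
  \row_(i < 3) m 0 (tix (lift ord_max i)).

(* The 4-fold brackets live in ratfun 4, with variables t_1^(1/2), t_2^(1/2),
   t_3^(1/2), y^(1/2) and t_4^(1/2) = (t_1 t_2 t_3)^(-1/2); the 3-fold ones
   in ratfun 3, with variables t_1^(1/2), t_2^(1/2), t_3^(1/2). *)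
Definition bracket4 (f : ratfun 5) : ratfun 4 :=
  bracket (push cy_exp (laurent_of f)).

Definition bracket3 (f : ratfun 5) : ratfun 3 :=
  bracket (push exp3 (laurent_of f)).

(* A formal Laurent series in q is given by its coefficients. *)
Definition qseries (K : Type) := int -> K.

(* A sign (-1)^b is recorded by the boolean b. *)
Definition V_DT (P : 'I_4 -> pfun) (sgn : solid -> bool) : qseries (ratfun 4) :=
  fun n => \sum_(p \in [set p | Pi_DT P p /\ vol_DT P p = n])
    ((-1) ^+ sgn p * bracket4 (- v_tilde P (fun t => Z_DT t p))).

Definition V_PT (P : 'I_4 -> pfun) (sgn : {fset weight} -> bool)
  : qseries (ratfun 4) :=
  fun n => \sum_(B \in [set B | Pi_PT P B /\ vol_PT P B = n])
    ((-1) ^+ sgn B * bracket4 (- v_tilde P (fun t => Z_PT t P B))).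

Definition V3D_DT (lam mu nu : pfun) : qseries (ratfun 3) :=
  let P := quad lam mu nu empty_pp in
  fun n => \sum_(p \in [set p | [/\ Pi_DT P p, supported_DT p & vol_DT P p = n]])
    bracket3 (- V3D P (fun t => Z_DT t p)).

Definition V3D_PT (lam mu : pfun) : qseries (ratfun 3) :=
  let P := quad lam mu empty_pp empty_pp in
  fun n => \sum_(B \in [set B | Pi_PT P B /\ vol_PT P B = n])
    bracket3 (- V3D P (fun t => Z_PT t P B)).

Definition sign_DT (P : 'I_4 -> pfun) (p : solid) : bool :=
  odd (absz (renorm_vol P (pi_CM P) + (nembedded P p)%:Z)).

Definition sign_PT (P : 'I_4 -> pfun) (B : {fset weight}) : bool :=
  odd (absz (renorm_vol P (pi_CM P) + #|` B|%:Z)).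

(* The point y^(1/2) = t_4^(1/2) = (t_1 t_2 t_3)^(-1/2). *)
Definition y_eq_t4 (j : 'I_4) : ratfun 3 :=
  if unlift ord_max j is Some i then rvar i else (\prod_(i < 3) rvar i)^-1.

Definition specializes_series (f : qseries (ratfun 4)) (g : qseries (ratfun 3))
  : Prop := forall n, specializes y_eq_t4 (f n) (g n).

End Vertices.

Section Series.

Variable K : fieldType.

Definition qmul (f g : qseries K) : qseries K :=
  fun n => \sum_(k \in [set: int]) (f k * g (n - k)).

Definition qconst (c : K) : qseries K := fun n => if n == 0 then c else 0.

Definition qpow (f : qseries K) (k : nat) : qseries K :=
  iter k (qmul f) (qconst 1).

(* q |-> -q *)
Definition qneg (f : qseries K) : qseries K := fun n => (-1) ^ n * f n.

(* For f without terms of order <= 0 in q. *)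
Definition qexp (f : qseries K) : qseries K :=
  fun n => \sum_(k \in [set: nat]) (qpow f k n / k`!%:R).

End Series.

Section PlethysticExponential.

(* All variables (including q and the square roots) are replaced by their n-th
   powers. *)
Definition adams (n : nat) (f : qseries (ratfun 4)) : qseries (ratfun 4) :=
  fun m => if (n%:Z %| m)%Z
           then ratsubst (fun i => rvar i ^+ n) (f (m %/ n%:Z)%Z) else 0.

Definition Exp (f : qseries (ratfun 4)) : qseries (ratfun 4) :=
  qexp (fun m => \sum_(n \in [set n : nat | (0 < n)%N]) (adams n f m / n%:R)).

(* Square roots of t_1, ..., t_4 and of y in ratfun 4. *)
Definition sqrt_t (a : 'I_4) : ratfun 4 :=
  if unlift ord_max a is Some i then rvar (lift ord_max i : 'I_4)
  else (\prod_(i < 3) rvar (lift ord_max i : 'I_4))^-1.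

Definition sqrt_y : ratfun 4 := rvar (ord_max : 'I_4).

(* [t_1 t_2][t_1 t_3][t_2 t_3][y] / ([t_1][t_2][t_3][t_4]) *)
Definition exp_arg_coef : ratfun 4 :=
  let s (i : 'I_4) := sqrt_t i in
  br (s 0 * s 1) * br (s 0 * s 2) * br (s 1 * s 2) * br sqrt_y
  / \prod_(a < 4) br (s a).

(* [y^(1/2) q][y^(1/2) q^-1], multiplied out:
   y^(1/2) + y^(-1/2) - q - q^-1. *)
Definition exp_arg_denom : qseries (ratfun 4) :=
  fun n => if n == 0 then sqrt_y + sqrt_y^-1
           else if (n == 1) || (n == -1) then -1 else 0.

(* The expansion in q of the argument of Exp is the power series f with
   f * exp_arg_denom = exp_arg_coef. *)
Definition is_exp_arg (f : qseries (ratfun 4)) : Prop :=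
  (forall n : int, n < 0 -> f n = 0) /\
  qmul f exp_arg_denom = qconst exp_arg_coef.

Definition Exp_signs (sgn0 : solid -> bool) : Prop :=
  exists2 f, is_exp_arg f & V_DT empty4 sgn0 = Exp f.

Definition unique_Exp_signs (sgn0 : solid -> bool) : Prop :=
  Exp_signs sgn0 /\
  forall sgn0', Exp_signs sgn0' ->
    forall p, Pi_DT empty4 p -> sgn0' p = sgn0 p.

End PlethysticExponential.

Section Correspondence.

Definition agree_at_order (P : 'I_4 -> pfun) (sD : solid -> bool)
  (sP : {fset weight} -> bool) (s0 : solid -> bool) (n : int) : Prop :=
  V_DT P sD n = qmul (V_PT P sP) (V_DT empty4 s0) n.

Definition realizes (P : 'I_4 -> pfun) (sD : solid -> bool)
  (sP : {fset weight} -> bool) (s0 : solid -> bool) : Prop :=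
  forall n, agree_at_order P sD sP s0 n.

(* The signs entering the coefficient of q^n are those of the p with |p| = n on
   the DT side and those of the B of order at most n on the PT side; an overall
   sign acts on both simultaneously. *)
Definition unique_up_to_sign_at (P : 'I_4 -> pfun) (s0 : solid -> bool)
  (n : int) : Prop :=
  forall sD sD' sP sP',
    agree_at_order P sD sP s0 n -> agree_at_order P sD' sP' s0 n ->
    exists eps : bool,
      (forall p, Pi_DT P p -> vol_DT P p = n -> sD' p = eps (+) sD p) /\
      (forall B, Pi_PT P B -> vol_PT P B <= n -> sP' B = eps (+) sP B).

Definition DTPT_correspondence : Prop :=
  forall P, four_plane_partitions P -> at_most_two_nonempty P ->
    (exists sD sP s0, realizes P sD sP s0) /\
    (forall s0, unique_Exp_signs s0 -> forall n, unique_up_to_sign_at P s0 n).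

Definition sign_compatibility : Prop :=
  forall P, four_plane_partitions P -> at_most_two_nonempty P ->
    exists sD sP s0,
      [/\ realizes P sD sP s0,
          forall p, Pi_DT P p -> supported_DT p -> sD p = sign_DT P p,
          forall B, Pi_PT P B -> supported_PT P B -> sP B = sign_PT P B &
          forall p, Pi_DT empty4 p -> supported_DT p ->
            s0 p = sign_DT empty4 p].

End Correspondence.

(* Main.v *)
Require Import Defs.
From mathcomp Require Import all_boot all_order all_algebra finmap.
From mathcomp Require Import boolp classical_sets.
From mathcomp Require Import functions cardinality fsbigop mpoly zify.
From Stdlib Require Ring Field.

(** The character of a DT or PT fixed point splits as
    [Z = Z' + sum_i Z_i / (1 - t_i)], where the Laurent polynomial [Z'] counts
    each weight [w] with multiplicity [1 - #(legs containing w)].  Substituting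
    this in the vertex, the terms [Z_i Zb_i] cancel against the edge terms and
    [v_tilde = A - y Zb'] with [A] and [Zb'] Laurent polynomials in [t];
    likewise the 3-fold vertex is [A - Zb' / (t_1 t_2 t_3)].  After imposing
    [t_1 t_2 t_3 t_4 = 1], the only monomials that can become trivial at
    [y = t_4] are the constant ones and those of the form [y / t_4].  The
    latter come from the weights [(k,k,k,k+1)], which lie in no leg.  If the
    partition contains a box with [x_4 > 0], it contains [(0,0,0,1)], so
    [-v_tilde] has a positive multiple of [y / t_4] and the bracket vanishes at
    [y = t_4].  Otherwise there is no such term and the 4-fold bracket
    specializes to the 3-fold one factor by factor.  On the PT side all box
    configurations lie in [x_4 = 0].  The signs produce [q |-> -q] since their
    exponent is the order in [q].  The last claim follows by specializing the
    4-fold correspondence term by term. *)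

Set Implicit Arguments.
Unset Strict Implicit.
Unset Printing Implicit Defensive.

Import Order.TTheory GRing.Theory Num.Theory.

Local Open Scope classical_set_scope.
Local Open Scope ring_scope.

(** * Laurent polynomials as lists of terms *)

(** Exponents may repeat and coefficients may vanish, so that sums and products are plain list
    operations; [coef] collects like terms. *)
Definition lseq (n : nat) := seq (int * 'rV[int]_n).

Definition lev (n : nat) (F : fieldType) (x : 'I_n -> F) (l : lseq n) : F :=
  \sum_(c <- l) c.1%:~R * mono x c.2.

Definition coef (n : nat) (l : lseq n) (m : 'rV[int]_n) : int :=
  \sum_(c <- l | c.2 == m) c.1.

Definition laurent_seq (n : nat) (L : laurent n) : lseq n :=
  [seq (L m, m) | m <- finsupp L].

Section Monomials.
Variables (n : nat) (F : fieldType) (x : 'I_n -> F).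
Hypothesis x0 : forall i, x i != 0.

Lemma mono0 : mono x 0 = 1.
Proof. by rewrite /mono big1 // => i _; rewrite mxE expr0z. Qed.

Lemma monoD u v : mono x (u + v) = mono x u * mono x v.
Proof.
rewrite /mono -big_split; apply: eq_bigr => i _.
by rewrite mxE expfzDr.
Qed.

Lemma mono_neq0 u : mono x u != 0.
Proof. by apply/prodf_neq0 => i _; rewrite expfz_neq0. Qed.

Lemma monoN u : mono x (- u) = (mono x u)^-1.
Proof.
by apply: (mulfI (mono_neq0 u)); rewrite -monoD subrr mono0 divff // mono_neq0.
Qed.

Lemma monoB u v : mono x (u - v) = mono x u / mono x v.
Proof. by rewrite monoD monoN. Qed.

Lemma mono_sum (I : Type) (r : seq I) (P : pred I) (f : I -> 'rV_n) :
  mono x (\sum_(i <- r | P i) f i) = \prod_(i <- r | P i) mono x (f i).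
Proof.
elim: r => [|i r IH]; first by rewrite !big_nil mono0.
by rewrite !big_cons; case: (P i); rewrite ?monoD IH.
Qed.

Lemma mono_delta i : mono x (delta_mx 0 i) = x i.
Proof.
rewrite /mono (bigD1 i) //= big1 ?mulr1 => [|j /negbTE ji].
  by rewrite mxE !eqxx expr1z.
by rewrite mxE eqxx /= ji expr0z.
Qed.

Lemma mono_inv u : mono (fun i => (x i)^-1) u = mono x (- u).
Proof.
by apply: eq_bigr => i _; rewrite mxE exprz_inv.
Qed.

End Monomials.

Section LaurentLists.
Variables (n : nat) (F : fieldType) (x : 'I_n -> F).

Lemma lev_cat l1 l2 : lev x (l1 ++ l2) = lev x l1 + lev x l2.
Proof. by rewrite /lev big_cat. Qed.

Lemma lev_scale a l : lev x [seq (a * c.1, c.2) | c <- l] = a%:~R * lev x l.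
Proof.
rewrite /lev big_map mulr_sumr; apply: eq_bigr => c _.
by rewrite intrM mulrA.
Qed.

(** Each term is a sum over the single element of [E] equal to its exponent; exchanging the two sums
    collects like terms. [E] may be any duplicate-free list covering the exponents. *)
Lemma lev_uniq (E : seq 'rV[int]_n) l : uniq E ->
  {subset [seq c.2 | c <- l] <= E} ->
  lev x l = \sum_(m <- E) (coef l m)%:~R * mono x m.
Proof.
move=> uE sub.
rewrite /lev (eq_big_seq (fun c => \sum_(m <- E | m == c.2) c.1%:~R * mono x m)); last first.
  move=> c cl; have cE : c.2 \in E by apply: sub; apply: map_f.
  rewrite -big_filter (_ : [seq m <- E | m == c.2] = [:: c.2]).
    by rewrite big_seq1.
  by rewrite (filter_pred1_uniq uE).
rewrite (exchange_big_dep xpredT) //=; apply: eq_bigr => m _.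
rewrite /coef rmorph_sum /= mulr_suml.
by apply: eq_bigl => c; rewrite eq_sym.
Qed.

End LaurentLists.

Section Laurent.
Variable n : nat.
Implicit Types (l : lseq n) (L : laurent n).

Lemma coef_cat l1 l2 m : coef (l1 ++ l2) m = coef l1 m + coef l2 m.
Proof. by rewrite /coef big_cat. Qed.

Lemma coef_scale a l m : coef [seq (a * c.1, c.2) | c <- l] m = a * coef l m.
Proof. by rewrite /coef big_map mulr_sumr. Qed.

Lemma coef_laurent_seq L m : coef (laurent_seq L) m = L m.
Proof.
rewrite /coef big_map /=.
have [mL|mL] := boolP (m \in finsupp L).
  rewrite -big_filter (filter_pred1_uniq _ mL) ?fset_uniq //.
  by rewrite big_seq1.
rewrite big_seq_cond big1 ?fsfun_dflt // => m' /andP[m'L /eqP E].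
by rewrite E (negbTE mL) in m'L.
Qed.

Lemma lev_laurent_seq L : lev (@rvar n) (laurent_seq L) = laurent_eval L.
Proof. by rewrite /lev big_map. Qed.

Lemma rvar_neq0 (i : 'I_n) : rvar i != 0.
Proof.
rewrite tofrac_eq0; apply/eqP => /(congr1 (fun p : {mpoly int[n]} => p@_U_(i)%MM)).
by rewrite mcoeffX mcoeff0 eqxx.
Qed.

Lemma coef_eq0_notin l m : m \notin [seq c.2 | c <- l] -> coef l m = 0.
Proof.
move=> ml; rewrite /coef big_seq_cond big1 // => c /andP[cl /eqP E].
by case/negP: ml; rewrite -E map_f.
Qed.

Lemma absz_shift (a : int) (N : nat) : (absz a <= N)%N -> 0 <= a + N%:Z.
Proof. lia. Qed.

(** Faithful on nonnegative exponents only; other exponents are first shifted into that range. *)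
Definition absexp (m : 'rV[int]_n) : 'X_{1..n} := [multinom absz (m 0%R i) | i < n].

Lemma mono_rvar_tofrac (m : 'rV[int]_n) : (forall i, 0 <= m 0 i) ->
  mono (@rvar n) m
  = FracField.tofrac ('X_[absexp m] : {mpoly int[n]}).
Proof.
move=> m0; rewrite mpolyXE_id rmorph_prod; apply: eq_bigr => i _.
rewrite rmorphXn /= mnmE -[in LHS](gez0_abs (m0 i)) -exprnP.
by [].
Qed.

Lemma tofrac_int (c : int) :
  FracField.tofrac (c%:MP_[n] : {mpoly int[n]}) = c%:~R.
Proof. by rewrite -[in LHS](intz c) !rmorph_int. Qed.

(** Distinct Laurent monomials are linearly independent. Multiplying by the [N]-th power of the
    product of the variables, with [N] bounding all exponents, moves the relation into the
    polynomial ring, where coefficients are compared. *)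
Lemma lev_rvar_eq0 l : lev (@rvar n) l = 0 -> forall m, coef l m = 0.
Proof.
move=> l0 m; have [ml|/coef_eq0_notin //] := boolP (m \in [seq c.2 | c <- l]).
pose E := undup [seq c.2 | c <- l].
pose N : nat := (\sum_(m <- E) \sum_i absz (m 0%R i))%N.
have Nb m' i : m' \in E -> (absz (m' 0%R i) <= N)%N.
  move=> m'E; rewrite /N (big_rem m') //= (bigD1 i) //=.
  by rewrite -addnA leq_addr.
move: N Nb => N Nb.
pose sh (m : 'rV[int]_n) := m + const_mx N%:Z.
have sh0 m' : m' \in E -> forall i, 0 <= sh m' 0 i.
  move=> /Nb h i; have {h} := h i; rewrite /sh !mxE.
  by move=> h; exact: (absz_shift h).
have uE : uniq E := undup_uniq _.
have := l0; rewrite (@lev_uniq _ _ _ E) //; last by move=> ?; rewrite mem_undup.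
move=> /(congr1 (fun f => f * mono (@rvar n) (const_mx N%:Z))).
rewrite mul0r mulr_suml.
rewrite (eq_big_seq (fun m' => FracField.tofrac
   ((coef l m') *: 'X_[absexp (sh m')] : {mpoly int[n]}))); last first.
  move=> m' m'E /=; rewrite -mulrA -monoD; last exact: rvar_neq0.
  rewrite -/(sh m') mono_rvar_tofrac; last exact: sh0.
  by rewrite -mul_mpolyC rmorphM /= tofrac_int.
rewrite -rmorph_sum /= => /eqP; rewrite tofrac_eq0 => /eqP.
move=> /(congr1 (fun p : {mpoly int[n]} =>
   p@_(absexp (sh m)))).
rewrite mcoeff0 raddf_sum /=.
have mE : m \in E by rewrite mem_undup.
rewrite (bigD1_seq m) //= linearZ /= mcoeffX eqxx mulr1.
rewrite big_seq_cond big1 ?addr0 // => m' /andP[m'E mm'].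
rewrite linearZ /= mcoeffX; case: eqP => [e|]; last by rewrite mulr0.
case/eqP: mm'; apply/rowP => i; move/mnmP/(_ i): e; rewrite !mnmE.
move=> /(congr1 Posz); rewrite !gez0_abs ?sh0 // /sh !mxE.
exact: addIr.
Qed.

Lemma lev_rvar_inj l1 l2 : lev (@rvar n) l1 = lev (@rvar n) l2 ->
  coef l1 =1 coef l2.
Proof.
move=> e m; apply/eqP; rewrite -subr_eq0 -mulN1r -coef_scale -coef_cat.
by apply/eqP/lev_rvar_eq0; rewrite lev_cat lev_scale e mulN1r subrr.
Qed.


(** Collecting the terms of [l] gives a representative, so [xget] does not return its default; any
    other representative has the same coefficients by [lev_rvar_inj]. *)
Lemma laurent_of_lev l : laurent_of (lev (@rvar n) l) =1 coef l.
Proof.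
move=> m; rewrite /laurent_of.
pose E := seq_fset tt [seq c.2 | c <- l].
pose L : laurent n := [fsfun m in E => coef l m | 0].
have LE m' : L m' = coef l m'.
  rewrite /L fsfunE seq_fsetE.
  by case: ifP => // /negbT /coef_eq0_notin ->.
have [L' -> /=|/(_ L)] := xgetP; last case.
  by rewrite -lev_laurent_seq => /lev_rvar_inj <-; rewrite coef_laurent_seq.
rewrite /= -lev_laurent_seq (@lev_uniq _ _ _ E (laurent_seq L)) ?fset_uniq //.
  rewrite (@lev_uniq _ _ _ E l) ?fset_uniq //.
    by apply: eq_bigr => m' _; rewrite coef_laurent_seq LE.
  by move=> m'; rewrite seq_fsetE.
rewrite -map_comp map_id => m'; rewrite mem_finsupp LE; apply: contraR.
by rewrite seq_fsetE => /coef_eq0_notin ->.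
Qed.

Lemma coef_map k (h : 'rV[int]_n -> 'rV[int]_k) l m (E : seq 'rV[int]_n) :
  uniq E -> {subset [seq c.2 | c <- l] <= E} ->
  coef [seq (c.1, h c.2) | c <- l] m = \sum_(m' <- E | h m' == m) coef l m'.
Proof.
move=> uE sub; rewrite /coef big_map /=.
rewrite (exchange_big_dep (fun c : int * 'rV[int]_n => h c.2 == m)) /=; last first.
  by move=> m' c hm /eqP ->.
rewrite [LHS]big_seq_cond [RHS]big_seq_cond.
apply: eq_bigr => c /andP[cl /eqP hc].
have cE : c.2 \in E by apply: sub; apply: map_f.
rewrite -big_filter (_ : [seq m' <- E | _] = [:: c.2]) ?big_seq1 //.
rewrite -(filter_pred1_uniq uE cE); apply: eq_filter => m'.
rewrite /= [c.2 == m']eq_sym; have [->|_] := eqVneq m' c.2; last by rewrite andbF.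
by rewrite hc eqxx.
Qed.

(** Like terms need not be collected before a substitution: any list presenting [L] will do. *)
Lemma push_coef k (h : 'rV[int]_n -> 'rV[int]_k) L l :
  L =1 coef l -> push h L =1 coef [seq (c.1, h c.2) | c <- l].
Proof.
move=> Ll m; pose E := undup [seq c.2 | c <- l].
have EL m' : m' \in finsupp L -> m' \in E.
  rewrite mem_finsupp Ll; apply: contraR.
  by rewrite mem_undup => /coef_eq0_notin ->.
rewrite (@coef_map _ _ _ _ E) ?undup_uniq //; last by move=> ?; rewrite mem_undup.
have -> : \sum_(m' <- E | h m' == m) coef l m'
        = \sum_(m' <- finsupp L | h m' == m) L m'.
  under eq_bigr do rewrite -Ll.
  rewrite (bigID (mem (finsupp L))) /= [X in _ + X]big1 ?addr0; last first.
    by move=> i /andP[_]; apply: fsfun_dflt.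
  rewrite -big_filter -[RHS]big_filter; apply: perm_big.
  apply: uniq_perm; rewrite ?filter_uniq ?undup_uniq ?fset_uniq // => m'.
  rewrite !mem_filter.
  case: (boolP (m' \in finsupp L)) => [/EL ->|_]; rewrite ?andbT ?andbF /= ?andbT ?andbF //.
rewrite fsfunE; case: ifP => // /negbT mh.
rewrite big_seq_cond big1 // => m' /andP[m'L /eqP hm].
by case/negP: mh; rewrite -hm; apply/imfsetP; exists m'.
Qed.

End Laurent.

(** * Specialization of rational functions *)

Section Specialization.
Variables (n : nat) (F : fieldType) (h : 'I_n -> F).
Implicit Types (f g : ratfun n) (v w : F) (p q : {mpoly int[n]}).

Lemma tofrac_neq0 q : mpeval h q != 0 -> FracField.tofrac q != 0.
Proof. by rewrite tofrac_eq0; apply: contraNneq => ->; rewrite /mpeval rmorph0. Qed.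

Lemma specializes_tofrac p : specializes h (FracField.tofrac p) (mpeval h p).
Proof.
exists p, 1; rewrite /mpeval !rmorph1 !divr1; split => //.
exact: oner_neq0.
Qed.

(** The cross-multiplied equality of the two fractions is evaluated at [h], where both denominators
    are nonzero. *)
Lemma specializes_unique f v w :
  specializes h f v -> specializes h f w -> v = w.
Proof.
move=> [p [q [q0 -> ->]]] [p' [q' [q'0 E ->]]].
apply/eqP; rewrite eqr_div //; move/eqP: E.
rewrite eqr_div ?tofrac_neq0 // -!tofracM tofrac_eq => /eqP E.
by apply/eqP; rewrite /mpeval -!(rmorphM (mmap _ _)) E.
Qed.

Lemma specializesD f g v w : specializes h f v -> specializes h g w ->
  specializes h (f + g) (v + w).
Proof.
move=> [p [q [q0 -> ->]]] [p' [q' [q'0 -> ->]]].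
exists (p * q' + p' * q), (q * q'); split.
- by rewrite /mpeval rmorphM mulf_neq0.
- by rewrite addf_div ?tofrac_neq0 // rmorphD !rmorphM.
- by rewrite addf_div // /mpeval rmorphD !rmorphM.
Qed.

Lemma specializesM f g v w : specializes h f v -> specializes h g w ->
  specializes h (f * g) (v * w).
Proof.
move=> [p [q [q0 -> ->]]] [p' [q' [q'0 -> ->]]].
exists (p * p'), (q * q'); split.
- by rewrite /mpeval rmorphM mulf_neq0.
- by rewrite mulf_div ?tofrac_neq0 // !rmorphM.
- by rewrite mulf_div // /mpeval !rmorphM.
Qed.

Lemma specializesV f v : specializes h f v -> v != 0 ->
  specializes h f^-1 v^-1.
Proof.
move=> [p [q [q0 -> ->]]]; rewrite mulf_eq0 negb_or => /andP[p0 _].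
by exists q, p; split; rewrite ?invf_div.
Qed.

Lemma specializes0 : specializes h 0 0.
Proof. by have := specializes_tofrac 0; rewrite tofrac0 /mpeval rmorph0. Qed.

Lemma specializes1 : specializes h 1 1.
Proof. by have := specializes_tofrac 1; rewrite tofrac1 /mpeval rmorph1. Qed.

Lemma specializesN f v : specializes h f v -> specializes h (- f) (- v).
Proof.
move=> fv; rewrite -mulN1r -[- v]mulN1r; apply: specializesM => //.
by have := specializes_tofrac (-1); rewrite rmorphN1 /mpeval rmorphN1.
Qed.

Lemma specializes_sign (b : bool) f v : specializes h f v ->
  specializes h ((-1) ^+ b * f) ((-1) ^+ b * v).
Proof. by case: b; rewrite ?expr1 ?expr0 ?mulN1r ?mul1r //; exact: specializesN. Qed.

Lemma specializesXn f v k : specializes h f v -> specializes h (f ^+ k) (v ^+ k).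
Proof.
move=> fv; elim: k => [|k IH]; first by rewrite !expr0; exact: specializes1.
by rewrite !exprS; exact: specializesM.
Qed.

(** A negative power of [f] would have a pole where [f] takes the value [0], hence the side
    condition. *)
Lemma specializesXz f v (z : int) : specializes h f v -> (v != 0) || (0 <= z) ->
  specializes h (f ^ z) (v ^ z).
Proof.
move=> fv; case: z => k; first by rewrite -!exprnP => _; exact: specializesXn.
rewrite orbF !NegzE -!exprnN => v0.
by apply: specializesV; rewrite ?expf_neq0 //; exact: specializesXn.
Qed.

Lemma specializes_sum (I : eqType) (r : seq I) (f : I -> ratfun n) (v : I -> F) :
  {in r, forall i, specializes h (f i) (v i)} ->
  specializes h (\sum_(i <- r) f i) (\sum_(i <- r) v i).
Proof.
elim: r => [|i r IH] fv; first by rewrite !big_nil; exact: specializes0.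
rewrite !big_cons; apply: specializesD; first by apply: fv; rewrite mem_head.
by apply: IH => j jr; apply: fv; rewrite inE jr orbT.
Qed.

Lemma specializes_prod (I : eqType) (r : seq I) (f : I -> ratfun n) (v : I -> F) :
  {in r, forall i, specializes h (f i) (v i)} ->
  specializes h (\prod_(i <- r) f i) (\prod_(i <- r) v i).
Proof.
elim: r => [|i r IH] fv; first by rewrite !big_nil; exact: specializes1.
rewrite !big_cons; apply: specializesM; first by apply: fv; rewrite mem_head.
by apply: IH => j jr; apply: fv; rewrite inE jr orbT.
Qed.

Lemma specializes_mono m : (forall i, h i != 0) ->
  specializes h (mono (@rvar n) m) (mono h m).
Proof.
move=> h0; apply: specializes_prod => i _; apply: specializesXz; last by rewrite h0.
have := specializes_tofrac 'X_i.
by rewrite /mpeval mmapX mmap1U.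
Qed.

Lemma specializes_br f v : specializes h f v -> v != 0 ->
  specializes h (br f) (br v).
Proof.
by move=> fv v0; apply: specializesD => //; apply: specializesN; exact: specializesV.
Qed.

End Specialization.

(** * Brackets at the point [y = t_4] *)

Lemma mono_rvar_inj n : injective (mono (@rvar n)).
Proof.
move=> u v uv.
have /lev_rvar_inj /(_ u) : lev (@rvar n) [:: (1, u)] = lev (@rvar n) [:: (1, v)].
  by rewrite /lev !big_seq1 uv.
by rewrite /coef !big_cons !big_nil eqxx; case: eqP => // ->.
Qed.

(** The equation [r = r^-1] for a monomial [r] of exponent [m] gives [m = - m], hence [m = 0] over
    the integers. *)
Lemma br_mono_eq0 n (m : 'rV[int]_n) : (br (mono (@rvar n) m) == 0) = (m == 0).
Proof.
apply/idP/eqP => [|->]; last by rewrite mono0 /br invr1 subrr.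
rewrite /br subr_eq0 -monoN; last exact: rvar_neq0.
move=> /eqP /mono_rvar_inj /eqP; rewrite -subr_eq0 opprK => /eqP mm.
have aux (a : int) : a + a = 0 -> a = 0 by lia.
by apply/rowP => i; move/rowP/(_ i): mm; rewrite !mxE; exact: aux.
Qed.

Lemma bracket_widen n (L : laurent n) (E : seq 'rV[int]_n) : uniq E ->
  {subset finsupp L <= E} ->
  bracket L = \prod_(m <- E) br (mono (@rvar n) m) ^ L m.
Proof.
move=> uE sub; rewrite /bracket.
rewrite [RHS](bigID (mem (finsupp L))) /= [X in _ * X]big1 ?mulr1; last first.
  by move=> m mL; rewrite (fsfun_dflt mL) expr0z.
rewrite -[RHS]big_filter; apply: perm_big; apply: uniq_perm.
- exact: fset_uniq.
- by rewrite filter_uniq.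
- by move=> m; rewrite mem_filter; case: (boolP (m \in finsupp L)) => // /sub ->.
Qed.

(* Exponents (t_1,t_2,t_3,y) after setting y = (t_1 t_2 t_3)^-1. *)
Definition y_t4_exp (m : 'rV[int]_4) : 'rV[int]_3 :=
  \row_(i < 3) (m 0 (lift ord_max i) - m 0 ord_max).

Lemma y_eq_t4_neq0 j : y_eq_t4 j != 0.
Proof.
rewrite /y_eq_t4; case: (unlift _ _) => [i|]; first exact: rvar_neq0.
by rewrite invr_eq0; apply/prodf_neq0 => i _; exact: rvar_neq0.
Qed.

Lemma mono_y_eq_t4 m : mono y_eq_t4 m = mono (@rvar 3) (y_t4_exp m).
Proof.
rewrite /mono big_ord_recr /= {2}/y_eq_t4 unlift_none exprz_inv.
rewrite (big_morph (fun x => x ^ (- m 0 ord_max))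
           (fun x y => expfzMl x y (- m 0 ord_max)) (exp1rz _ (- m 0 ord_max))).
rewrite -big_split; apply: eq_bigr => i _.
rewrite mxE expfzDr ?rvar_neq0 //; congr (_ * _).
have -> : widen_ord (leqnSn 3) i = lift ord_max i :> 'I_4.
  by apply: val_inj; rewrite /= /bump leqNgt ltn_ord.
by rewrite /y_eq_t4 liftK.
Qed.

Lemma br_y_t4_specializes (m : 'rV[int]_4) :
  specializes y_eq_t4 (br (mono (@rvar 4) m)) (br (mono (@rvar 3) (y_t4_exp m))).
Proof.
rewrite -mono_y_eq_t4.
apply: specializes_br; last by apply: mono_neq0; exact: y_eq_t4_neq0.
by apply: specializes_mono; exact: y_eq_t4_neq0.
Qed.

Lemma y_t4_exp0 : y_t4_exp 0 = 0.
Proof. by apply/rowP => i; rewrite !mxE subrr. Qed.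

(** The factors specialize one by one. A nonconstant monomial that becomes trivial must have
    positive multiplicity, since otherwise its factor would have a pole. *)
Lemma prod_br_specializes (L : laurent 4) :
  {in finsupp L, forall m, y_t4_exp m = 0 -> m != 0 -> 0 < L m} ->
  specializes y_eq_t4 (bracket L)
    (\prod_(m <- finsupp L) br (mono (@rvar 3) (y_t4_exp m)) ^ L m).
Proof.
move=> Lpos; apply: specializes_prod => m mL.
have [->|m0] := eqVneq m 0.
  (* The constant monomial gives the factor [0 ^ L 0] before and after; for [L 0] nonzero of either
     sign this is [0], as [0^-1 = 0]. *)
  rewrite y_t4_exp0 !mono0 /br !invr1 !subrr.
  have [->|L0] := eqVneq (L 0) 0; first by rewrite !expr0z; exact: specializes1.
  rewrite !exp0rz (negbTE L0); exact: specializes0.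
apply: specializesXz; first exact: br_y_t4_specializes.
rewrite br_mono_eq0; have [s0|//] := eqVneq (y_t4_exp m) 0.
by rewrite ltW // Lpos.
Qed.

Lemma bracket_specializes0 (L : laurent 4) m0 :
  {in finsupp L, forall m, y_t4_exp m = 0 -> m != 0 -> 0 < L m} ->
  y_t4_exp m0 = 0 -> L m0 != 0 ->
  specializes y_eq_t4 (bracket L) 0.
Proof.
move=> Lpos s0 L0; have := prod_br_specializes Lpos.
rewrite (big_fsetD1 m0) ?mem_finsupp //= s0 mono0 /br invr1 subrr.
by rewrite exp0rz (negbTE L0) mul0r.
Qed.

(* If only the trivial monomial becomes trivial, both brackets carry it with the
   same multiplicity, hence both vanish ([0^-1 = 0]) as soon as it occurs. *)
Lemma bracket_specializes (L : laurent 4) (L3 : laurent 3) :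
  {in finsupp L, forall m, y_t4_exp m = 0 -> m = 0} ->
  L3 =1 push y_t4_exp L ->
  specializes y_eq_t4 (bracket L) (bracket L3).
Proof.
move=> Linj L3E.
have Lpos : {in finsupp L, forall m, y_t4_exp m = 0 -> m != 0 -> 0 < L m}.
  by move=> m mL /(Linj _ mL) ->; rewrite eqxx.
have := prod_br_specializes Lpos.
set b := \prod_(m <- _) _; suff -> : b = bracket L3 by [].
pose E := undup [seq y_t4_exp m | m <- finsupp L].
have LE := push_coef y_t4_exp (fun m => esym (coef_laurent_seq L m)).
have subE m : m \in finsupp L -> y_t4_exp m \in E.
  by move=> mL; rewrite mem_undup map_f.
rewrite (@bracket_widen _ _ E) ?undup_uniq //; last first.
  move=> m'; rewrite mem_finsupp L3E LE; apply: contraR => m'E.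
  rewrite coef_eq0_notin //; apply: contra m'E.
  by rewrite -map_comp => /mapP[c /mapP[m mL ->] ->]; apply: subE.
rewrite /b (eq_big_seq (fun m => \prod_(m' <- E | m' == y_t4_exp m)
     br (mono (@rvar 3) m') ^ L m)); last first.
  move=> m /subE mE; rewrite -big_filter.
  by rewrite (filter_pred1_uniq _ mE) ?undup_uniq // big_seq1.
rewrite (exchange_big_dep xpredT) //=; apply: eq_bigr => m' _.
rewrite L3E LE /coef !big_map /=.
(* Merging the factors of a fibre uses [x ^ (a + b) = x ^ a * x ^ b], which fails for [x = 0]. Over
   the trivial exponent the fibre is instead shown to contain at most the exponent [0]. *)
have [->|m'0] := eqVneq m' 0.
  rewrite mono0 /br invr1 subrr.
  have hE m : m \in finsupp L -> (y_t4_exp m == 0) = (m == 0).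
    move=> mL; apply/eqP/eqP => [/(Linj _ mL) //|->]; exact: y_t4_exp0.
  have [oL|oL] := boolP (0 \in finsupp L).
    have fE : [seq m <- finsupp L | y_t4_exp m == 0] = [:: 0].
      rewrite -(filter_pred1_uniq (fset_uniq _) oL).
      by apply: eq_in_filter => m mL; rewrite hE.
    rewrite -[in RHS]big_filter fE big_seq1 -big_filter.
    under eq_filter do rewrite eq_sym.
    by rewrite fE big_seq1.
  have F0 m : m \in finsupp L -> (y_t4_exp m == 0) = false.
    by move=> mL; rewrite hE //; apply: contraNF oL => /eqP <-.
  rewrite [LHS]big_seq_cond [LHS]big_pred0; last first.
    by move=> m; rewrite eq_sym; case mL: (m \in finsupp L); rewrite //= F0.
  rewrite [X in 0 ^ X]big_seq_cond [X in 0 ^ X]big_pred0 ?expr0z // => m.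
  by case mL: (m \in finsupp L); rewrite //= F0.
have b0 : br (mono (@rvar 3) m') != 0 by rewrite br_mono_eq0.
rewrite (eq_bigl (fun m => y_t4_exp m == m')); last by move=> m; rewrite eq_sym.
elim: (finsupp L : seq _) => [|m r IH]; first by rewrite !big_nil expr0z.
by rewrite !big_cons; case: ifP => //; rewrite expfzDr // IH.
Qed.

(** * Vertex identities *)

(** Carries the identities proved below for abstract operations over to any [fieldType]. *)
Lemma mathcomp_field_theory (F : fieldType) :
  Field_theory.field_theory (0 : F) 1 +%R *%R (fun x y => x - y) -%R
    (fun x y => x / y) GRing.inv eq.
Proof.
split; [split|by apply/eqP; exact: oner_neq0|by []|by move=> x /eqP; exact: mulVf].
- exact: add0r.
- exact: addrC.
- exact: addrA.
- exact: mul1r.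
- exact: mulrC.
- exact: mulrA.
- exact: mulrDl.
- by [].
- exact: subrr.
Qed.

(* The [field] tactic works on unbundled operations only. *)
Section VertexIdentities.

Variables (R : Type) (r0 r1 : R) (radd rmul rsub : R -> R -> R) (ropp : R -> R)
  (rdiv : R -> R -> R) (rinv : R -> R).
Variable Rth : Field_theory.field_theory r0 r1 radd rmul rsub ropp rdiv rinv eq.
Import Stdlib.setoid_ring.Ring Stdlib.setoid_ring.Field.
Add Field Rfield : Rth.

Local Notation "0" := r0.
Local Notation "1" := r1.
Local Infix "+" := radd.
Local Infix "*" := rmul.
Local Infix "-" := rsub.
Local Infix "/" := rdiv.
Local Notation "- x" := (ropp x).
Local Notation "x ^-1" := (rinv x).

Variables (t0 t1 t2 y Z Zb Z0 Z1 Z2 B0 B1 B2 : R).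
Hypotheses (t0_neq0 : t0 <> 0) (t1_neq0 : t1 <> 0) (t2_neq0 : t2 <> 0).
Hypotheses (s0_neq0 : 1 - t0 <> 0) (s1_neq0 : 1 - t1 <> 0) (s2_neq0 : 1 - t2 <> 0).

Let u0 := t0^-1.
Let u1 := t1^-1.
Let u2 := t2^-1.
Let A := Z - ((1 - u0) * (1 - u1) * (1 - u2) * Z * Zb
  + (1 - u1) * (1 - u2) * Z * B0 + (1 - u0) * (1 - u2) * Z * B1
  + (1 - u0) * (1 - u1) * Z * B2 - u0 * (1 - u1) * (1 - u2) * Zb * Z0
  - u1 * (1 - u0) * (1 - u2) * Zb * Z1 - u2 * (1 - u0) * (1 - u1) * Zb * Z2
  - u0 * (1 - u2) * Z0 * B1 - u0 * (1 - u1) * Z0 * B2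
  - u1 * (1 - u2) * Z1 * B0 - u1 * (1 - u0) * Z1 * B2
  - u2 * (1 - u1) * Z2 * B0 - u2 * (1 - u0) * Z2 * B1).
Let W := Z + (Z0 / (1 - t0) + (Z1 / (1 - t1) + Z2 / (1 - t2))).
Let Wb := Zb + (B0 / (1 - u0) + (B1 / (1 - u1) + B2 / (1 - u2))).

(** Clearing the denominators [1 - t^-1] produces factors [t - 1], so the side conditions come with
    this sign. *)
Let opp_s_neq0 t : 1 - t <> 0 -> t - 1 <> 0.
Proof.
move=> sn E; apply: sn.
have -> : 1 - t = - (t - 1) by ring.
by rewrite E; ring.
Qed.

(** All letters are independent here. Since [1 / (1 - t^-1) = - t / (1 - t)], the linear terms in
    [Z_i] and [B_i] cancel, the products [Z_i B_i] cancel against the edge terms, and the cross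
    terms lose their poles through [(1 - t^-1) / (1 - t) = - t^-1]. *)
Lemma v_tilde_identity :
  W - y * Wb - (1 - u0) * ((1 - u1) * (1 - u2)) * W * Wb
  + (  (- Z0 - t0 * y * B0 + (1 - t1) / t1 * ((1 - t2) / t2) * Z0 * B0) / (1 - t0)
    + ((- Z1 - t1 * y * B1 + (1 - t0) / t0 * ((1 - t2) / t2) * Z1 * B1) / (1 - t1)
    +  (- Z2 - t2 * y * B2 + (1 - t0) / t0 * ((1 - t1) / t1) * Z2 * B2) / (1 - t2)))
  = A - y * Zb.
Proof.
rewrite /A /W /Wb /u0 /u1 /u2; field.
do ?split => //; exact: opp_s_neq0.
Qed.

(** This is the previous identity at [y = (t0 t1 t2)^-1], with the same [A]. *)
Lemma V3D_identity :
  W - Wb / (t0 * (t1 * t2))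
  + ((1 - t0) * ((1 - t1) * (1 - t2))) / (t0 * (t1 * t2)) * W * Wb
  + ((1 - t0)^-1 * (- Z0 - B0 / (t1 * t2)
                     + (1 - t1) / t1 * ((1 - t2) / t2) * Z0 * B0)
    + ((1 - t1)^-1 * (- Z1 - B1 / (t0 * t2)
                     + (1 - t0) / t0 * ((1 - t2) / t2) * Z1 * B1)
    + (1 - t2)^-1 * (- Z2 - B2 / (t0 * t1)
                     + (1 - t0) / t0 * ((1 - t1) / t1) * Z2 * B2)))
  = A - (t0 * (t1 * t2))^-1 * Zb.
Proof.
rewrite /A /W /Wb /u0 /u1 /u2; field.
do ?split => //; exact: opp_s_neq0.
Qed.

End VertexIdentities.

(* The y-free part of the vertex; [u_i] is the inverse of [t_i] and [B_i] the
   conjugate of [Z_i]. *)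
Definition vertex_part (F : fieldType) (u0 u1 u2 Z Zb Z0 Z1 Z2 B0 B1 B2 : F) : F :=
  Z - ((1 - u0) * (1 - u1) * (1 - u2) * Z * Zb
  + (1 - u1) * (1 - u2) * Z * B0 + (1 - u0) * (1 - u2) * Z * B1
  + (1 - u0) * (1 - u1) * Z * B2 - u0 * (1 - u1) * (1 - u2) * Zb * Z0
  - u1 * (1 - u0) * (1 - u2) * Zb * Z1 - u2 * (1 - u0) * (1 - u1) * Zb * Z2
  - u0 * (1 - u2) * Z0 * B1 - u0 * (1 - u1) * Z0 * B2
  - u1 * (1 - u2) * Z1 * B0 - u1 * (1 - u0) * Z1 * B2
  - u2 * (1 - u1) * Z2 * B0 - u2 * (1 - u0) * Z2 * B1).

Section VertexPart.
Variables (F : fieldType) (t0 t1 t2 Z Zb Z0 Z1 Z2 B0 B1 B2 : F).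
Hypotheses (t0_neq0 : t0 != 0) (t1_neq0 : t1 != 0) (t2_neq0 : t2 != 0).
Hypotheses (s0_neq0 : 1 - t0 != 0) (s1_neq0 : 1 - t1 != 0) (s2_neq0 : 1 - t2 != 0).

Let W := Z + (Z0 / (1 - t0) + (Z1 / (1 - t1) + Z2 / (1 - t2))).
Let Wb := Zb + (B0 / (1 - t0^-1) + (B1 / (1 - t1^-1) + B2 / (1 - t2^-1))).
Let A := vertex_part t0^-1 t1^-1 t2^-1 Z Zb Z0 Z1 Z2 B0 B1 B2.

Lemma v_tilde_vertex_part y :
  W - y * Wb - (1 - t0^-1) * ((1 - t1^-1) * (1 - t2^-1)) * W * Wb
  + (  (- Z0 - t0 * y * B0 + (1 - t1) / t1 * ((1 - t2) / t2) * Z0 * B0) / (1 - t0)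
    + ((- Z1 - t1 * y * B1 + (1 - t0) / t0 * ((1 - t2) / t2) * Z1 * B1) / (1 - t1)
    +  (- Z2 - t2 * y * B2 + (1 - t0) / t0 * ((1 - t1) / t1) * Z2 * B2) / (1 - t2)))
  = A - y * Zb.
Proof.
by apply: (v_tilde_identity (mathcomp_field_theory F)); apply/eqP.
Qed.

Lemma V3D_vertex_part :
  W - Wb / (t0 * (t1 * t2))
  + ((1 - t0) * ((1 - t1) * (1 - t2))) / (t0 * (t1 * t2)) * W * Wb
  + ((1 - t0)^-1 * (- Z0 - B0 / (t1 * t2)
                     + (1 - t1) / t1 * ((1 - t2) / t2) * Z0 * B0)
    + ((1 - t1)^-1 * (- Z1 - B1 / (t0 * t2)
                     + (1 - t0) / t0 * ((1 - t2) / t2) * Z1 * B1)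
    + (1 - t2)^-1 * (- Z2 - B2 / (t0 * t1)
                     + (1 - t0) / t0 * ((1 - t1) / t1) * Z2 * B2)))
  = A - (t0 * (t1 * t2))^-1 * Zb.
Proof.
by apply: (V3D_identity (mathcomp_field_theory F)); apply/eqP.
Qed.

End VertexPart.

(** [vertex_part] contains no division, so it stays in any subring [S] containing its arguments; [S]
    will be the Laurent polynomials, possibly without [t_4]. *)
Lemma vertex_part_closed (F : fieldType) (S : F -> Prop)
  (u0 u1 u2 Z Zb Z0 Z1 Z2 B0 B1 B2 : F) :
  S 1 -> (forall f g, S f -> S g -> S (f + g)) -> (forall f, S f -> S (- f)) ->
  (forall f g, S f -> S g -> S (f * g)) ->
  S u0 -> S u1 -> S u2 -> S Z -> S Zb -> S Z0 -> S Z1 -> S Z2 ->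
  S B0 -> S B1 -> S B2 -> S (vertex_part u0 u1 u2 Z Zb Z0 Z1 Z2 B0 B1 B2).
Proof.
move=> S1 SD SN SM; rewrite /vertex_part => *.
by do ![assumption | apply: (SN) | apply: (SD) | apply: (SM)].
Qed.

(** * The vertex as a Laurent polynomial *)

Lemma tvar_neq0 a : tvar a != 0.
Proof. exact: rvar_neq0. Qed.

Lemma tinv_neq0 a : tinv a != 0.
Proof. by rewrite invr_eq0 tvar_neq0. Qed.

Lemma tvar_sub_neq0 a : 1 - tvar a != 0.
Proof.
rewrite subr_eq0; apply/eqP => e.
have /(@mono_rvar_inj 5) : mono (@rvar 5) 0 = mono (@rvar 5) (delta_mx 0 (tix a)).
  by rewrite mono0 mono_delta.
by move/rowP/(_ (tix a)); rewrite !mxE !eqxx.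
Qed.

Lemma tinv_sub_neq0 a : 1 - tinv a != 0.
Proof.
rewrite -(inj_eq (mulfI (tvar_neq0 a))) mulr0 mulrBr mulr1 divff ?tvar_neq0 //.
by rewrite -opprB oppr_eq0 tvar_sub_neq0.
Qed.

Lemma lev_tinv l : lev tinv l = lev tvar [seq (c.1, - c.2) | c <- l].
Proof. by rewrite /lev big_map; apply: eq_bigr => c _; rewrite mono_inv. Qed.

(* [lpoly b f]: f is a Laurent polynomial in t_1, ..., t_4, and even in
   t_1, t_2, t_3 if b holds. *)
Definition x4_free (b : bool) (l : lseq 4) : bool :=
  b ==> all (fun c : int * weight => c.2 0 ord_max == 0) l.

Definition lpoly (b : bool) (f : ratfun 5) : Prop :=
  exists2 l : lseq 4, x4_free b l & f = lev tvar l.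

Lemma lev_nil n (F : fieldType) (x : 'I_n -> F) : lev x [::] = 0.
Proof. by rewrite /lev big_nil. Qed.

Section LPoly.
Variable b : bool.

Lemma x4_free_cat l1 l2 : x4_free b l1 -> x4_free b l2 -> x4_free b (l1 ++ l2).
Proof. by rewrite /x4_free all_cat; case: b => //= -> ->. Qed.

Lemma lpolyD f g : lpoly b f -> lpoly b g -> lpoly b (f + g).
Proof.
move=> [l lb ->] [l' l'b ->]; exists (l ++ l'); first exact: x4_free_cat.
by rewrite lev_cat.
Qed.

Lemma lpolyN f : lpoly b f -> lpoly b (- f).
Proof.
move=> [l lb ->]; exists [seq (-1 * c.1, c.2) | c <- l].
  by move: lb; rewrite /x4_free all_map.
by rewrite lev_scale mulN1r.
Qed.

Lemma lpolyM f g : lpoly b f -> lpoly b g -> lpoly b (f * g).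
Proof.
move=> [l lb ->] [l' l'b ->].
exists [seq (c.1 * d.1, c.2 + d.2) | c <- l, d <- l'].
  move: lb l'b; rewrite /x4_free; case: b => //= /allP lb /allP l'b.
  apply/allP => _ /allpairsP[[c d] /= [cl dl ->]] /=.
  by rewrite mxE (eqP (lb _ cl)) (eqP (l'b _ dl)).
rewrite /lev mulr_suml big_allpairs_dep /=; apply: eq_bigr => c _.
rewrite mulr_sumr; apply: eq_bigr => d _.
rewrite intrM monoD; last exact: tvar_neq0.
by rewrite mulrACA.
Qed.

Lemma lpoly_lev l : x4_free b l -> lpoly b (lev tvar l).
Proof. by exists l. Qed.

Lemma lpoly_lev_tinv l : x4_free b l -> lpoly b (lev tinv l).
Proof.
rewrite lev_tinv; exists [seq (c.1, - c.2) | c <- l] => //.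
move: H; rewrite /x4_free all_map; case: b => //=; apply: sub_all => c /=.
by rewrite mxE oppr_eq0.
Qed.

Lemma lpoly_tinv a : a != ord_max -> lpoly b (tinv a).
Proof.
move=> a3; exists [:: (1, - delta_mx 0 a)].
  rewrite /x4_free /= !mxE [ord_max == _]eq_sym (negbTE a3) andbF oppr0 eqxx.
  by rewrite implybT.
rewrite /lev big_seq1 mul1r monoN ?mono_delta //; exact: tvar_neq0.
Qed.

Lemma lpoly1 : lpoly b 1.
Proof.
exists [:: (1, 0)]; first by rewrite /x4_free /= mxE eqxx implybT.
by rewrite /lev big_seq1 mono0 mulr1.
Qed.

End LPoly.

Lemma big_axes (R : Type) (idx : R) (op : Monoid.law idx) (F : 'I_4 -> R) :
  \big[op/idx]_(i < 4 | i != ord_max) F i = op (F 0) (op (F 1) (F 2)).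
Proof.
rewrite big_mkcond !big_ord_recl big_ord0 /= !Monoid.mulm1.
by congr (op (F _) (op (F _) (F _))); apply: val_inj.
Qed.

Lemma big_axes0 (R : Type) (idx : R) (op : Monoid.law idx) (F : 'I_4 -> R) :
  \big[op/idx]_(i < 4 | (i != ord_max) && (i != 0)) F i = op (F 1) (F 2).
Proof.
rewrite big_mkcondr big_axes /= Monoid.mul1m.
by [].
Qed.

Lemma big_axes1 (R : Type) (idx : R) (op : Monoid.law idx) (F : 'I_4 -> R) :
  \big[op/idx]_(i < 4 | (i != ord_max) && (i != 1)) F i = op (F 0) (F 2).
Proof.
rewrite big_mkcondr big_axes /= Monoid.mul1m.
by [].
Qed.

Lemma big_axes2 (R : Type) (idx : R) (op : Monoid.law idx) (F : 'I_4 -> R) :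
  \big[op/idx]_(i < 4 | (i != ord_max) && (i != 2)) F i = op (F 0) (F 1).
Proof.
rewrite big_mkcondr big_axes /= Monoid.mulm1.
by [].
Qed.

(* The redistribution of a character along the legs, Z = Z' + sum_i Z_i/(1-t_i)
   with Z' the Laurent polynomial of lc. *)
Definition leg_decomposition (P : 'I_4 -> pfun)
  (chi : ('I_4 -> ratfun 5) -> ratfun 5) (lc : lseq 4) (t : 'I_4 -> ratfun 5) :=
  chi t = lev t lc + \sum_(i < 4 | i != ord_max) Z_leg t P i / (1 - t i).

Section VertexFormulas.
Variables (F : fieldType) (t Zl Bl : 'I_4 -> F) (y Z Zb : F).
Hypothesis t_neq0 : forall a, t a != 0.
Hypothesis s_neq0 : forall a, 1 - t a != 0.
Hypotheses (Zl_max : Zl ord_max = 0) (Bl_max : Bl ord_max = 0).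

Let ti a := (t a)^-1.
Let W := Z + \sum_(i < 4 | i != ord_max) Zl i / (1 - t i).
Let Wb := Zb + \sum_(i < 4 | i != ord_max) Bl i / (1 - ti i).
Let A := vertex_part (ti 0) (ti 1) (ti 2) Z Zb
  (Zl 0) (Zl 1) (Zl 2) (Bl 0) (Bl 1) (Bl 2).

(** With an empty fourth leg the whole [1 / (1 - t_4)] term vanishes, which leaves the identity in
    three axes. *)
Lemma v_tilde_formula :
  W - y * Wb - \prod_(i < 4 | i != ord_max) (1 - ti i) * W * Wb
  + \sum_(i < 4 | i != ord_max) (- Zl i - t i * y * Bl i
    + (\prod_(a < 4 | (a != ord_max) && (a != i)) ((1 - t a) / t a))
      * Zl i * Bl i) / (1 - t i)
  + (1 - t ord_max)^-1 *
    (- Zl ord_max - t ord_max * y * Bl ord_max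
     + \prod_(i < 4 | i != ord_max) (1 - ti i)
       * (Wb * Zl ord_max - W * Bl ord_max)
     + \prod_(i < 4 | i != ord_max) (1 - ti i) / (1 - t ord_max)
       * Zl ord_max * Bl ord_max)
  = A - y * Zb.
Proof.
rewrite Zl_max Bl_max !mulr0 subrr mulr0 oppr0 !addr0 mulr0 addr0.
rewrite /W /Wb !big_axes big_axes0 big_axes1 big_axes2.
exact: v_tilde_vertex_part.
Qed.

Lemma V3D_formula :
  W - Wb / \prod_(i < 4 | i != ord_max) t i
  + (\prod_(i < 4 | i != ord_max) (1 - t i)) / (\prod_(i < 4 | i != ord_max) t i)
    * W * Wb
  + \sum_(i < 4 | i != ord_max) (1 - t i)^-1 *
      (- Zl i
       - Bl i / \prod_(a < 4 | (a != ord_max) && (a != i)) t a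
       + (\prod_(a < 4 | (a != ord_max) && (a != i)) ((1 - t a) / t a))
         * Zl i * Bl i)
  = A - (t 0 * (t 1 * t 2))^-1 * Zb.
Proof.
rewrite /W /Wb !big_axes !big_axes0 !big_axes1 !big_axes2.
exact: V3D_vertex_part.
Qed.

End VertexFormulas.

Section VertexLaurent.
Variables (P : 'I_4 -> pfun) (chi : ('I_4 -> ratfun 5) -> ratfun 5).
Variables (b : bool) (lc : lseq 4) (ll : 'I_4 -> lseq 4).
Hypothesis chi_tvar : leg_decomposition P chi lc tvar.
Hypothesis chi_tinv : leg_decomposition P chi lc tinv.
Hypothesis Z_leg_lev : forall a t, Z_leg t P a = lev t (ll a) :> ratfun 5.
Hypothesis ll_free : forall a, x4_free b (ll a).
Hypothesis ll_max : ll ord_max = [::].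
Hypothesis lc_free : x4_free b lc.

(** One and the same [l0] serves both vertices; this makes the 4-fold and 3-fold brackets comparable
    term by term. *)
Lemma vertex_laurent : exists l0,
  [/\ x4_free b l0,
      v_tilde P chi = lev tvar l0 - yvar * lev tinv lc &
      V3D P chi
      = lev tvar l0 - (tvar 0 * (tvar 1 * tvar 2))^-1 * lev tinv lc].
Proof.
pose A := vertex_part (tinv 0) (tinv 1) (tinv 2) (lev tvar lc) (lev tinv lc)
  (lev tvar (ll 0)) (lev tvar (ll 1)) (lev tvar (ll 2))
  (lev tinv (ll 0)) (lev tinv (ll 1)) (lev tinv (ll 2)).
have [l0 l0b A0] : lpoly b A.
  apply: vertex_part_closed.
  - exact: lpoly1.
  - exact: lpolyD.
  - exact: lpolyN.
  - exact: lpolyM.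
  - exact: lpoly_tinv.
  - exact: lpoly_tinv.
  - exact: lpoly_tinv.
  - exact: lpoly_lev.
  - exact: lpoly_lev_tinv.
  - exact: lpoly_lev.
  - exact: lpoly_lev.
  - exact: lpoly_lev.
  - exact: lpoly_lev_tinv.
  - exact: lpoly_lev_tinv.
  - exact: lpoly_lev_tinv.
exists l0; rewrite -A0 /A -!Z_leg_lev; split => //.
  have Z_max t : Z_leg t P ord_max = 0 :> ratfun 5.
    by rewrite Z_leg_lev ll_max lev_nil.
  rewrite -(@v_tilde_formula _ tvar (Z_leg tvar P) (Z_leg tinv P) yvar
    (lev tvar lc) (lev tinv lc) tvar_neq0 tvar_sub_neq0 (Z_max _) (Z_max _)).
  by rewrite /v_tilde chi_tvar chi_tinv.
rewrite -(@V3D_formula _ tvar (Z_leg tvar P) (Z_leg tinv P)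
  (lev tvar lc) (lev tinv lc) tvar_neq0 tvar_sub_neq0).
by rewrite /V3D chi_tvar chi_tinv.
Qed.

(* Exponent of y^k t^w in ratfun 5. *)
Definition with_y (k : int) (w : 'rV[int]_4) : 'rV[int]_5 :=
  \row_j if unlift ord_max j is Some a then w 0 a else k.

Lemma with_y_tix k w a : with_y k w 0 (tix a) = w 0 a.
Proof. by rewrite mxE liftK. Qed.

Lemma with_y_max k w : with_y k w 0 ord_max = k.
Proof. by rewrite mxE unlift_none. Qed.

Lemma mono_with_y k w : mono (@rvar 5) (with_y k w) = yvar ^ k * mono tvar w.
Proof.
rewrite /mono big_ord_recr /= mulrC with_y_max; congr (_ * _).
apply: eq_bigr => i _.
have -> : widen_ord (leqnSn 4) i = tix i.
  by apply: val_inj; rewrite /= /bump leqNgt ltn_ord.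
by rewrite with_y_tix.
Qed.

Lemma lev_with_y k l :
  lev (@rvar 5) [seq (c.1, with_y k c.2) | c <- l] = yvar ^ k * lev tvar l.
Proof.
rewrite /lev big_map mulr_sumr; apply: eq_bigr => c _ /=.
by rewrite mono_with_y mulrCA.
Qed.

Definition ones3 : 'rV[int]_4 := \row_i (i != ord_max)%:R.

(* The terms of -v_tilde of the form y t^(-w) that become trivial at y = t_4. *)
Definition trivial_y_coef (l : lseq 4) : int :=
  \sum_(c <- l | [forall i : 'I_3, c.2 0 (lift ord_max i) == c.2 0 ord_max - 1])
    c.1.


Lemma mono_ones3 : mono tvar ones3 = tvar 0 * (tvar 1 * tvar 2).
Proof.
rewrite -(big_axes _ (fun i => tvar i)) big_mkcond; apply: eq_bigr => i _.
by rewrite mxE; case: (i != ord_max).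
Qed.

(** Terms of [- v_tilde]: hence the sign on [l0], and the conjugated exponents in the part carrying
    [y]. *)
Definition v_tilde_seq (l0 : lseq 4) : lseq 5 :=
  [seq (-1 * c.1, with_y 0 c.2) | c <- l0]
  ++ [seq (c.1, with_y 1 (- c.2)) | c <- lc].

(** Here [y] is replaced by [(t_1 t_2 t_3)^-1], which is the shift by [- ones3]. *)
Definition V3D_seq (l0 : lseq 4) : lseq 5 :=
  [seq (-1 * c.1, with_y 0 c.2) | c <- l0]
  ++ [seq (c.1, with_y 0 (- c.2 - ones3)) | c <- lc].

Lemma laurent_of_vertex : exists l0,
  [/\ x4_free b l0,
      laurent_of (- v_tilde P chi) =1 coef (v_tilde_seq l0) &
      laurent_of (- V3D P chi) =1 coef (V3D_seq l0)].
Proof.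
have [l0 [l0b -> ->]] := vertex_laurent; exists l0; split => //.
  move=> m; rewrite -laurent_of_lev; congr (laurent_of _ _).
  rewrite opprB addrC lev_cat; congr (_ + _).
    have := lev_with_y 0 [seq (-1 * c.1, c.2) | c <- l0].
    by rewrite expr0z mul1r -map_comp lev_scale mulN1r => <-.
  have := lev_with_y 1 [seq (c.1, - c.2) | c <- lc].
  by rewrite expr1z -map_comp lev_tinv => <-.
move=> m; rewrite -laurent_of_lev; congr (laurent_of _ _).
rewrite opprB addrC lev_cat; congr (_ + _).
  have := lev_with_y 0 [seq (-1 * c.1, c.2) | c <- l0].
  by rewrite expr0z mul1r -map_comp lev_scale mulN1r => <-.
have := lev_with_y 0 [seq (c.1, - c.2 - ones3) | c <- lc].
rewrite expr0z mul1r -map_comp => ->.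
rewrite -mono_ones3 lev_tinv /lev !big_map mulr_sumr; apply: eq_bigr => c _ /=.
by rewrite mulrCA monoB 1?(mulrC (_^-1)) //; exact: tvar_neq0.
Qed.

Lemma cy_exp_with_y k w (i : 'I_3) :
  cy_exp (with_y k w) 0 (lift ord_max i) = w 0 (lift ord_max i) - w 0 ord_max.
Proof. by rewrite mxE liftK !with_y_tix. Qed.

Lemma cy_exp_with_y_max k w : cy_exp (with_y k w) 0 ord_max = k.
Proof. by rewrite mxE unlift_none with_y_max. Qed.

Lemma rV4P (u v : 'rV[int]_4) :
  (forall i : 'I_3, u 0 (lift ord_max i) = v 0 (lift ord_max i)) ->
  u 0 ord_max = v 0 ord_max -> u = v.
Proof.
move=> uv uv_max; apply/rowP => i.
by case: (unliftP ord_max i) => [j|] ->.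
Qed.

Lemma y_t4_exp_eq0 m : y_t4_exp m = 0 -> m = const_mx (m 0 ord_max).
Proof.
move=> m0; apply: rV4P => [i|]; rewrite mxE //.
by move/rowP/(_ i): m0; rewrite !mxE => /eqP; rewrite subr_eq0 => /eqP.
Qed.

Section CYCoefficients.
Variable l0 : lseq 4.
Let L4 := push cy_exp (laurent_of (- v_tilde P chi)).
Hypothesis L4E : laurent_of (- v_tilde P chi) =1 coef (v_tilde_seq l0).

Lemma cy_coef : L4 =1 coef [seq (c.1, cy_exp c.2) | c <- v_tilde_seq l0].
Proof. exact: push_coef. Qed.

(** Once [t_1 t_2 t_3 t_4 = 1], the vector [const_mx 1] is the exponent of [y / t_4]. Terms of [l0]
    have [y]-exponent [0] and do not contribute. *)
Lemma cy_coef_ones : L4 (const_mx 1) = trivial_y_coef lc.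
Proof.
rewrite cy_coef map_cat coef_cat /coef -!map_comp !big_map /=.
rewrite big_pred0 ?add0r => [|c]; last first.
  apply/eqP => /rowP/(_ ord_max).
  by rewrite cy_exp_with_y_max mxE.
have aux (a d : int) : - a - - d = 1 <-> a = d - 1 by lia.
apply: eq_bigl => c; apply/eqP/forallP => [/rowP e i|e].
  have := e (lift ord_max i); rewrite cy_exp_with_y !mxE => {}e.
  by apply/eqP/aux.
apply: rV4P => [i|]; last by rewrite cy_exp_with_y_max mxE.
by rewrite cy_exp_with_y !mxE; apply/aux/eqP.
Qed.

(** The kernel of [y_t4_exp] consists of the multiples of [(1,1,1,1)], and every term has
    [y]-exponent [0] or [1]. *)
Lemma cy_coef_trivial m : m \in finsupp L4 -> y_t4_exp m = 0 -> m != 0 ->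
  m = const_mx 1.
Proof.
rewrite mem_finsupp cy_coef => mL /y_t4_exp_eq0 mE m0; rewrite mE.
have : m \in [seq c.2 | c <- [seq (c.1, cy_exp c.2) | c <- v_tilde_seq l0]].
  by apply: contraR mL => /coef_eq0_notin ->.
rewrite -map_comp => /mapP[c + mc].
have := congr1 (fun m : 'rV_4 => m 0 ord_max) mc.
rewrite mem_cat => m_max /orP[] /mapP[d _ cE]; move: m_max.
  rewrite cE /= cy_exp_with_y_max => m_max.
  by move: m0; rewrite mE m_max; case/eqP; apply/rowP => i; rewrite !mxE.
by rewrite cE /= cy_exp_with_y_max => ->.
Qed.

End CYCoefficients.

Lemma bracket4_specializes0 : 0 < trivial_y_coef lc ->
  specializes y_eq_t4 (bracket4 (- v_tilde P chi)) 0.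
Proof.
move=> lc_pos; have [l0 [_ L4E _]] := laurent_of_vertex.
apply: (@bracket_specializes0 _ (const_mx 1)).
- by move=> m mL m0 /(cy_coef_trivial L4E mL m0) ->; rewrite (cy_coef_ones L4E).
- by apply/rowP => i; rewrite !mxE subrr.
- by rewrite (cy_coef_ones L4E) gt_eqF.
Qed.

(** By [cy_coef_trivial] only the constant monomial can still become trivial. As no exponent
    involves [t_4], applying [cy_exp] and then [y_t4_exp] to [v_tilde_seq] agrees term by term with
    [exp3] on [V3D_seq]. *)
Lemma bracket4_specializes : b -> trivial_y_coef lc = 0 ->
  specializes y_eq_t4 (bracket4 (- v_tilde P chi)) (bracket3 (- V3D P chi)).
Proof.
move=> b_true lc_0; have [l0 [l0b L4E L3E]] := laurent_of_vertex.
apply: bracket_specializes => m.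
  move=> mL m0; apply/eqP; apply: contraLR mL.
  move=> mN0; apply/negP => mL.
  have m1 := cy_coef_trivial L4E mL m0 mN0.
  by move: mL; rewrite mem_finsupp m1 (cy_coef_ones L4E) lc_0 eqxx.
rewrite (push_coef exp3 L3E) (push_coef y_t4_exp (cy_coef L4E)).
move: l0b lc_free; rewrite /x4_free b_true => /= /allP l0_free /allP lc_free3.
congr (coef _ m); rewrite !map_cat -!map_comp; congr (_ ++ _).
  apply/eq_in_map => c /l0_free /eqP cl /=; congr (_, _); apply/rowP => i.
  rewrite [RHS]mxE mxE cy_exp_with_y cy_exp_with_y_max !with_y_tix cl.
  by rewrite !subr0.
apply/eq_in_map => c /lc_free3 /eqP cl /=; congr (_, _); apply/rowP => i.
rewrite [RHS]mxE mxE cy_exp_with_y cy_exp_with_y_max !with_y_tix !mxE cl.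
by rewrite oppr0 subr0 eq_sym neq_lift.
Qed.

End VertexLaurent.

(** * Generating functions *)

Definition ind (S : set weight) (w : weight) : int := (`[< S w >] : nat)%:Z.

Lemma ind1 S w : S w -> ind S w = 1.
Proof. by move=> Sw; rewrite /ind asboolT. Qed.

Lemma ind0 S w : ~ S w -> ind S w = 0.
Proof. by move=> Sw; rewrite /ind asboolF. Qed.

(** Extends [numer_coef] linearly from indicators to integer-valued functions: multiplication of the
    formal series of [f] by all factors [1 - t_i]. *)
Definition numer (f : weight -> int) (w : weight) : int :=
  \sum_(A : {set 'I_4}) (-1) ^+ #|A| * f (w - \sum_(i in A) e_ i).

Section FiniteSums.
Variables (F : fieldType) (t : 'I_4 -> F).
Hypothesis t_neq0 : forall i, t i != 0.

Definition has_sum (f : weight -> int) (v : F) : Prop :=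
  exists2 l : lseq 4, f =1 coef l & v = lev t l.

Lemma has_sumD f g u v : has_sum f u -> has_sum g v ->
  has_sum (fun w => f w + g w) (u + v).
Proof.
move=> [l fl ->] [k gk ->]; exists (l ++ k); last by rewrite lev_cat.
by move=> w; rewrite coef_cat fl gk.
Qed.

Lemma has_sumZ a f v : has_sum f v -> has_sum (fun w => a * f w) (a%:~R * v).
Proof.
move=> [l fl ->]; exists [seq (a * c.1, c.2) | c <- l]; last by rewrite lev_scale.
by move=> w; rewrite coef_scale fl.
Qed.

Lemma has_sum_shift e f v : has_sum f v ->
  has_sum (fun w => f (w - e)) (mono t e * v).
Proof.
move=> [l fl ->]; exists [seq (c.1, c.2 + e) | c <- l].
  move=> w; rewrite fl /coef big_map; apply: eq_bigl => c /=.
  by rewrite eq_sym subr_eq eq_sym.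
rewrite /lev big_map mulr_sumr; apply: eq_bigr => c _ /=.
by rewrite monoD // mulrCA (mulrC (mono t e)).
Qed.

Lemma has_sum_sum (I : Type) (r : seq I) (Q : pred I) (f : I -> weight -> int)
    (v : I -> F) : (forall i, Q i -> has_sum (f i) (v i)) ->
  has_sum (fun w => \sum_(i <- r | Q i) f i w) (\sum_(i <- r | Q i) v i).
Proof.
move=> fv; elim: r => [|i r [l fl e]].
  by exists [::] => [w|]; rewrite ?/coef ?/lev !big_nil.
have [Qi|Qi] := boolP (Q i); last first.
  exists l; rewrite ?big_cons ?(negbTE Qi) // => w.
  by rewrite big_cons (negbTE Qi) fl.
have [l' fl' e'] := fv _ Qi; exists (l' ++ l); last first.
  by rewrite big_cons Qi lev_cat e e'.
by move=> w; rewrite big_cons Qi coef_cat fl fl'.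
Qed.

Lemma has_sum_ext f g v : f =1 g -> has_sum f v -> has_sum g v.
Proof. by move=> fg [l fl ->]; exists l => // w; rewrite -fg fl. Qed.

Lemma has_sumE f v : has_sum f v ->
  \sum_(w \in [set: weight]) (f w)%:~R * mono t w = v.
Proof.
move=> [l fl ->]; pose E := seq_fset tt [seq c.2 | c <- l].
rewrite (@fsbigTE _ _ _ _ E) => [|w].
  rewrite (@lev_uniq _ _ _ E) ?fset_uniq // => [|w]; last by rewrite seq_fsetE.
  by apply: eq_bigr => w _; rewrite fl.
by rewrite seq_fsetE fl => /coef_eq0_notin ->; rewrite mul0r.
Qed.

Lemma prod_sub1_subsets (Q : pred 'I_4) : \prod_(i | Q i) (1 - t i)
  = \sum_(A : {set 'I_4} | A \subset Q)
      ((-1) ^+ #|A|)%:~R * mono t (\sum_(i in A) e_ i).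
Proof.
rewrite big_mkcond /=.
(* A factor outside [Q] is written [0 + 1], so subsets not contained in [Q] contribute zero. *)
under eq_bigr => i _.
  rewrite (_ : (if Q i then _ else _) = (if Q i then - t i else 0) + 1); last first.
    by case: (Q i); rewrite 1?addrC ?addr0.
  over.
rewrite bigA_distr [RHS]big_mkcond /=; apply: eq_bigr => A _.
case: ifPn => [/fintype.subsetP AQ|/fintype.subsetPn[i iA iQ]]; last first.
  have {}iQ : Q i = false by apply: negbTE iQ.
  by rewrite (bigD1 i) //= iA iQ mul0r.
rewrite -big_mkcond /= (eq_bigr (fun i => - t i)) => [|i /AQ Qi]; last first.
  by have -> : Q i = true by [].
rewrite prodrN rmorphXn rmorphN1; congr (_ * _).
by rewrite mono_sum //; apply: eq_bigr => i _; rewrite mono_delta.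
Qed.

Lemma has_sum_numer f v : has_sum f v ->
  has_sum (numer f) (\prod_(i < 4) (1 - t i) * v).
Proof.
move=> fv; rewrite (prod_sub1_subsets predT) mulr_suml.
apply: (@has_sum_ext (fun w => \sum_(A : {set 'I_4} | A \subset predT)
  (-1) ^+ #|A| * f (w - \sum_(i in A) e_ i))).
  by move=> w; apply: eq_bigl => A; rewrite subset_predT.
apply: has_sum_sum => A _; rewrite -mulrA.
exact/has_sumZ/has_sum_shift.
Qed.

(** Pairing each [A] avoiding [a] with [a |: A] applies the factor [1 - t_a] first. *)
Lemma numer_pair f a w : numer f w
  = \sum_(A : {set 'I_4} | A \subset predC1 a) (-1) ^+ #|A| *
      (f (w - \sum_(i in A) e_ i) - f (w - \sum_(i in A) e_ i - e_ a)).
Proof.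
rewrite /numer (bigID (fun A : {set 'I_4} => a \in A)) /=.
rewrite (reindex_onto (fun A => a |: A) (fun A => A :\ a)) /=; last first.
  by move=> A aA; rewrite finset.setD1K.
have aC (A : {set 'I_4}) : (a \notin A) = (A \subset predC1 a).
  apply/idP/fintype.subsetP => [aA i iA|sA]; last by apply/negP => /sA; rewrite inE eqxx.
  by rewrite inE; apply: contraNneq aA => <-.
rewrite (eq_bigl (fun A : {set 'I_4} => A \subset predC1 a)); last first.
  move=> A; rewrite -aC finset.setU11 /=; apply/eqP/idP => [<-|/finset.setU1K //].
  by rewrite !inE eqxx.
rewrite [X in _ + X](eq_bigl (fun A : {set 'I_4} => A \subset predC1 a)) //.
rewrite -big_split; apply: eq_bigr => A; rewrite -aC => aA.
rewrite cardsU1 aA big_setU1 //= exprS mulN1r mulrBr addrC mulNr.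
by rewrite opprD (addrC (- e_ a)) addrA.
Qed.

(** Only the difference of [f] along [a] has to be finitely supported, which allows [f] to be the
    indicator of an infinite leg. *)
Lemma has_sum_numer_pair f a v :
  has_sum (fun w => f w - f (w - e_ a)) v ->
  has_sum (numer f) (\prod_(i < 4 | i != a) (1 - t i) * v).
Proof.
move=> fv; rewrite (prod_sub1_subsets (predC1 a)) mulr_suml.
apply: (has_sum_ext (fun w => esym (numer_pair f a w))).
apply: has_sum_sum => A _; rewrite -mulrA; apply: has_sumZ.
exact: (@has_sum_shift _ (fun w => f w - f (w - e_ a))).
Qed.

End FiniteSums.

(** * Legs *)

Lemma finite_nat_pairs_bounded (A : set (nat * nat)) : finite_set A ->
  exists M, forall p, A p -> (p.1 < M)%N /\ (p.2 < M)%N.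
Proof.
move=> fA; exists (\sum_(p <- fset_set A) (p.1 + p.2).+1)%N => p Ap.
rewrite (big_fsetD1 p) /=; last by rewrite in_fset_set // inE.
by split; rewrite ltn_addr // ltnS ?leq_addr ?leq_addl.
Qed.

Definition cube (M : nat) : set weight :=
  [set w | forall i, - M%:Z <= w 0 i < M%:Z].

Lemma finite_cube M : finite_set (cube M).
Proof.
pose g (f : {ffun 'I_4 -> 'I_(M + M)}) : weight := \row_i ((f i : nat)%:Z - M%:Z).
apply: (sub_finite_set (B := g @` [set: {ffun 'I_4 -> 'I_(M + M)}])); last first.
  exact/finite_image/finite_finset.
move=> w wM.
have wlt i : (absz (w 0 i + M%:Z)%R < M + M)%N.
  by have := wM i; move: (w 0 i) => a; clear; lia.
exists [ffun i => Ordinal (wlt i)] => //; apply/rowP => i.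
rewrite mxE ffunE /= gez0_abs ?addrK //.
by have := wM i; move: (w 0 i) => a; clear; lia.
Qed.

Lemma e_E (j i : 'I_4) : e_ j 0 i = (i == j)%:R.
Proof. by rewrite mxE eqxx. Qed.

Section Legs.
Variable P : 'I_4 -> pfun.
Hypothesis P_line : forall a, is_line_partition (P a).
Hypothesis P_max : P ord_max = empty_pp.

Lemma line_partitions_bounded : exists2 M, (0 < M)%N &
  forall a x y, (0 < P a x y)%N -> (x < M)%N /\ (y < M)%N.
Proof.
have /choice [M MP] a : exists M, forall p, (0 < P a p.1 p.2)%N ->
    (p.1 < M)%N /\ (p.2 < M)%N.
  have [[_ _ /finite_nat_pairs_bounded [M MP]] _] := P_line a.
  by exists M => p p0; apply: MP; rewrite /= -lt0n.
exists (\sum_a M a).+1 => // a x y /(MP a (x, y)) [/= xM yM].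
by rewrite (bigD1 a) //=; split; rewrite ltnS ltnW // ltn_addr.
Qed.

Lemma lift2_max (a : 'I_4) : a != ord_max -> lift a (2 : 'I_3) = ord_max.
Proof.
move=> a3; apply: val_inj => /=; rewrite /bump.
suff -> : (a <= 2)%N by [].
by move: (ltn_ord a); rewrite ltnS leq_eqVlt => /orP[|//]; rewrite -(inj_eq val_inj) /= in a3; rewrite (negbTE a3).
Qed.

Lemma ext_leg_shift a (w w' : weight) : ext_leg P a w ->
  (forall i, i != a -> w' 0 i = w 0 i) -> ext_leg P a w'.
Proof.
move=> [x [y [z [hx hy hz hP]]]] ww'; exists x, y, z.
by rewrite !ww' // eq_sym neq_lift.
Qed.

Section Bounds.
Variable M : nat.
Hypothesis M_gt0 : (0 < M)%N.
Hypothesis P_lt : forall a x y, (0 < P a x y)%N -> (x < M)%N /\ (y < M)%N.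

(** For [a] among the first three axes, the height coordinate of the leg is [x_4], and entries at
    most [1] force it to be [0]. The other two transverse coordinates index a nonzero entry, hence
    are below [M]. *)
Lemma ext_leg_coords a w : ext_leg P a w ->
  [/\ a != ord_max, w 0 ord_max = 0 &
      forall i, i != a -> 0 <= w 0 i < M%:Z].
Proof.
move=> [x [y [z [hx hy hz hP]]]].
have Pxy : (0 < P a x y)%N by apply: leq_ltn_trans hP.
have a3 : a != ord_max.
  by apply: contraTneq Pxy => ->; rewrite P_max.
have z0 : z = 0%N.
  have [_ /(_ x y) P1] := P_line a.
  by move: (leq_trans hP P1); rewrite ltnS leqn0 => /eqP.
have [xM yM] := P_lt Pxy.
split=> //; first by rewrite -(lift2_max a3) hz z0.
move=> i ia; have [j ->|E] := unliftP a i; last by rewrite E eqxx in ia.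
have [->|->|->] : [\/ j = 0, j = 1 | j = 2].
  case: j => [[|[|[|//]]] ?]; [apply: Or31|apply: Or32|apply: Or33]; exact: val_inj.
- by rewrite hx lez_nat ltz_nat.
- by rewrite hy lez_nat ltz_nat.
- by rewrite hz z0.
Qed.

(** Every coordinate is transverse to at least one of two distinct axes. *)
Lemma leg_cube a b w : a != b -> leg P a w -> leg P b w -> cube M w.
Proof.
move=> ab [/ext_leg_coords [_ _ wa] _] [/ext_leg_coords [_ _ wb] _] i.
have : 0 <= w 0 i < M%:Z.
  by have [E|/wa //] := eqVneq i a; apply: wb; rewrite E.
by move: (w 0 i) => c; clear; lia.
Qed.

Lemma nlegs_sum w : (nlegs P w)%:Z = \sum_a ind (leg P a) w.
Proof.
rewrite /nlegs -sum1_card big_mkcond /= (big_morph Posz PoszD erefl).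
by apply: eq_bigr => a _; rewrite /ind inE; case: asboolP.
Qed.

Lemma nlegs_gt0 w : (0 < nlegs P w)%N <-> pi_CM P w.
Proof.
rewrite /nlegs; split=> [|[a aw]].
  by case/card_gt0P=> a; rewrite inE => aw; exists a.
by apply/card_gt0P; exists a; rewrite inE.
Qed.

Lemma nlegs_gt1_cube w : (1 < nlegs P w)%N -> cube M w.
Proof.
move=> /card_gt1P[a [b [aw bw ab]]]; move: aw bw; rewrite !inE => aw bw.
exact: leg_cube ab aw bw.
Qed.

End Bounds.

Definition section_seq (a : 'I_4) : lseq 4 :=
  [seq (1, w) | w <- fset_set [set w | leg P a w /\ w 0 a = 0]].

Lemma finite_section a : finite_set [set w | leg P a w /\ w 0 a = 0].
Proof.
have [M M0 PM] := line_partitions_bounded.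
apply: sub_finite_set (finite_cube M) => w [[/(ext_leg_coords M0 PM) [_ _ wM] _] wa] i.
have [->|/wM] := eqVneq i a; last by move: (w 0 i) => c; clear; lia.
by rewrite wa; move: M0; clear; lia.
Qed.

Lemma Z_leg_section (F : fieldType) (t : 'I_4 -> F) a :
  Z_leg t P a = lev t (section_seq a).
Proof.
rewrite /Z_leg fsbig_finite; last exact: finite_section.
by rewrite /lev big_map; apply: eq_bigr => w _; rewrite mul1r.
Qed.

Lemma coef_indicator (A : set weight) (f : weight -> int) w : finite_set A ->
  coef [seq (f w, w) | w <- fset_set A] w = f w * ind A w.
Proof.
move=> fA; rewrite /coef big_map /=.
have [Aw|Aw] := pselect (A w).
  rewrite ind1 // mulr1 -big_filter (filter_pred1_uniq _) ?fset_uniq ?big_seq1 //.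
  by rewrite in_fset_set // inE.
rewrite ind0 // mulr0 big_seq_cond big1 // => w' /andP[].
by rewrite in_fset_set // inE => Aw' /eqP E; case: Aw; rewrite -E.
Qed.

(** A leg and its translate by [e_ a] differ exactly in the first slice, where the [a]-th coordinate
    is [0]. *)
Lemma leg_difference a w :
  ind (leg P a) w - ind (leg P a) (w - e_ a) = coef (section_seq a) w.
Proof.
rewrite (coef_indicator (fun=> 1)); last exact: finite_section.
rewrite mul1r.
have ea i : i != a -> (w - e_ a) 0 i = w 0 i.
  by move=> /negbTE ia; rewrite mxE [X in _ + X]mxE e_E ia subr0.
have eaa : (w - e_ a) 0 a = w 0 a - 1 by rewrite mxE [X in _ + X]mxE e_E eqxx.
have shift : ext_leg P a (w - e_ a) <-> ext_leg P a w.
  by split=> /ext_leg_shift; apply=> i /ea.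
have [wl|wl] := pselect (ext_leg P a w); last first.
  rewrite !ind0 ?subrr //.
  - by case=> -[].
  - by case=> /shift.
  - by case.
have [w0|w0] := boolP (0 <= w 0 a); last first.
  rewrite !ind0 ?subrr //.
  - by case=> -[_ h] _; rewrite h in w0.
  - case=> _; rewrite eaa.
    by move: w0; move: (w 0 a) => c; clear; lia.
  - by case=> _ h; rewrite h in w0.
have [w1|w1] := eqVneq (w 0 a) 0.
  rewrite ind1 // [ind _ (w - _)]ind0 ?subr0 ?ind1 // => -[_].
  by rewrite eaa w1.
rewrite [RHS]ind0 => [|[_ h]]; last by rewrite h eqxx in w1.
rewrite !ind1 ?subrr //; split=> //; first exact/shift.
by rewrite eaa; move: w0 w1; move: (w 0 a) => c; clear; lia.
Qed.


(** The coefficient of [t^w] in [Z']. For [S] containing [pi_CM] it is [1 - nlegs] on [S] and [0]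
    elsewhere. *)
Definition defect (S : set weight) (w : weight) : int :=
  ind S w - (nlegs P w)%:Z.

Definition defect_support (S : set weight) : set weight :=
  [set w | defect S w != 0].

Definition defect_seq (S : set weight) : lseq 4 :=
  [seq (defect S w, w) | w <- fset_set (defect_support S)].

Lemma defect_out S w : ~ pi_CM P w -> defect S w = ind S w.
Proof.
move=> wCM; rewrite /defect.
suff -> : nlegs P w = 0%N by rewrite subr0.
by apply/eqP; rewrite -leqn0 leqNgt; apply/negP => /nlegs_gt0.
Qed.

Lemma finite_multi_leg : finite_set [set w | (1 < nlegs P w)%N].
Proof.
have [M M0 PM] := line_partitions_bounded.
by apply: sub_finite_set (finite_cube M) => w; exact: nlegs_gt1_cube.
Qed.

Section Superset.
Variable S : set weight.
Hypothesis CM_S : pi_CM P `<=` S.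
Hypothesis S_fin : finite_set (S `\` pi_CM P).

(** The defect vanishes on weights lying in exactly one leg, so only embedded boxes and
    intersections of legs remain. *)
Lemma finite_defect : finite_set (defect_support S).
Proof.
apply: (sub_finite_set (B := (S `\` pi_CM P) `|` [set w | (1 < nlegs P w)%N])).
  move=> w; rewrite /defect_support /= => dw.
  have [wCM|wCM] := pselect (pi_CM P w); last first.
    left; split=> //; apply: contrapT => wS.
    by move: dw; rewrite defect_out // ind0 ?eqxx.
  right; move: dw; rewrite /defect ind1 /=; last exact: CM_S.
  by move/nlegs_gt0: wCM; case: (nlegs P w) => [|[]].
by rewrite finite_setU; split=> //; exact: finite_multi_leg.
Qed.

Lemma coef_defect_seq w : coef (defect_seq S) w = defect S w.
Proof.
rewrite (coef_indicator (defect S)); last exact: finite_defect.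
have [->|d0] := eqVneq (defect S w) 0; first by rewrite mul0r.
by rewrite ind1 ?mulr1.
Qed.

(** The indicator of [S] is the defect plus the indicators of the legs. In the numerator the defect
    keeps all four factors [1 - t_i], while leg [a] uses up the factor [1 - t_a] to become its
    section. *)
Lemma gen_fun_defect (F : fieldType) (t : 'I_4 -> F) :
  (forall i, t i != 0) -> (forall i, 1 - t i != 0) ->
  gen_fun t S = lev t (defect_seq S)
    + \sum_(i < 4 | i != ord_max) Z_leg t P i / (1 - t i).
Proof.
move=> t0 s0; have s_all : \prod_(i < 4) (1 - t i) != 0 by apply/prodf_neq0.
have defS : has_sum t (defect S) (lev t (defect_seq S)).
  by exists (defect_seq S) => // w; rewrite coef_defect_seq.
have legS a : has_sum t (fun w => ind (leg P a) w - ind (leg P a) (w - e_ a))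
    (Z_leg t P a).
  by exists (section_seq a); rewrite ?Z_leg_section // => w; exact: leg_difference.
have numerS w : numer_coef S w
    = numer (defect S) w + \sum_a numer (ind (leg P a)) w.
  rewrite /numer exchange_big -big_split; apply: eq_bigr => A _ /=.
  rewrite -mulr_sumr -mulrDr; congr (_ * _).
  by rewrite /defect nlegs_sum subrK.
rewrite /gen_fun.
have -> : \sum_(w \in [set: weight]) (numer_coef S w)%:~R * mono t w
    = \prod_(i < 4) (1 - t i) * lev t (defect_seq S)
      + \sum_a \prod_(i < 4 | i != a) (1 - t i) * Z_leg t P a.
  apply: has_sumE; apply: (has_sum_ext (fun w => esym (numerS w))).
  apply: has_sumD; first exact: has_sum_numer.
  by apply: has_sum_sum => a _; exact: has_sum_numer_pair.
rewrite mulrDl mulrAC mulfV // mul1r; congr (_ + _).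
(* The fourth leg is empty, so its section contributes nothing. *)
rewrite (bigD1 ord_max) //= Z_leg_section /section_seq.
rewrite (_ : [set w | _] = set0) ?fset_set0 ?lev_nil ?mulr0 ?add0r; last first.
  rewrite -subset0 => w [[[x [y [z [_ _ _]]]]]].
  by rewrite P_max ltn0.
rewrite mulr_suml; apply: eq_bigr => a _.
rewrite [X in _ / X](bigD1 a) //=; set Q := \prod_(i < 4 | i != a) _.
have Q0 : Q != 0 by apply/prodf_neq0 => i _.
by rewrite [Q * _]mulrC -mulf_div divff // mulr1.
Qed.

(** Weights in exactly one leg contribute [0] and boxes outside all legs contribute [1]; both
    volumes share the sum over intersections of legs. *)
Lemma renorm_volE :
  renorm_vol P S = renorm_vol P (pi_CM P) + #|` fset_set (S `\` pi_CM P)|%:Z.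
Proof.
pose T : set weight := [set w | (1 < nlegs P w)%N].
have T_CM : T `<=` pi_CM P by move=> w /= w1; apply/nlegs_gt0; rewrite ltnW.
have CM1 w : pi_CM P w -> ~ T w -> 1 - (nlegs P w)%:Z = 0.
  by move=> /nlegs_gt0; rewrite /T /=; case: (nlegs P w) => [|[]].
rewrite /renorm_vol -(@fsbig_widen _ _ _ _ ((S `\` pi_CM P) `|` T)); first last.
- by move=> w [wS /not_orP[wCM wT]] /=; apply: CM1 => //; apply: contrapT => /(conj wS).
- by move=> w [[]//|/T_CM /CM_S].
rewrite fsbigU0 //; [|exact: finite_multi_leg|by move=> w [[_ nCM] /T_CM]].
rewrite addrC -(@fsbig_widen _ _ _ _ T (pi_CM P)) //; last first.
  by move=> w [wCM wT]; exact: CM1.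
congr (_ + _).
rewrite fsbig_finite // (eq_big_seq (fun=> 1)) => [|w].
  by rewrite big_const_seq count_predT iter_addr_0 /= natz.
rewrite in_fset_set // inE => -[_ wCM].
suff -> : nlegs P w = 0%N by [].
by apply/eqP; rewrite -leqn0 leqNgt; apply/negP => /nlegs_gt0.
Qed.

End Superset.

End Legs.

(** * Fixed points *)

Lemma finite_set_inj_on (T U : Type) (f : T -> U) (A : set T) (B : set U) :
  finite_set B -> (forall x, A x -> B (f x)) ->
  (forall x y, A x -> A y -> f x = f y -> x = y) -> finite_set A.
Proof.
move=> fB AB f_inj.
have inj : {in A &, injective f} by move=> x y; rewrite !inE; exact: f_inj.
rewrite -(eq_finite_set (inj_card_eq inj)).
by apply: sub_finite_set fB => _ [x Ax <-]; exact: AB.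
Qed.

Lemma finite_subsets (T : choiceType) (A : set T) : finite_set A ->
  finite_set [set X : {fset T} | forall x, x \in X -> A x].
Proof.
move=> fA; apply: sub_finite_set (finite_fset (fpowerset (fset_set A))) => X XA /=.
rewrite fpowersetE; apply/fsubsetP => x /XA Ax.
by rewrite in_fset_set // inE.
Qed.

Definition wt4 (i j k l : nat) : weight :=
  \row_(a < 4) (nth 0%N [:: i; j; k; l] a)%:Z.

Lemma ge0_wt4 (w : weight) : (forall a, 0 <= w 0 a) ->
  exists i j k l, w = wt4 i j k l.
Proof.
move=> w0; exists (absz (w 0%R 0%R)), (absz (w 0%R 1%R)), (absz (w 0%R 2%R)),
  (absz (w 0%R ord_max)).
apply/rowP => a; rewrite mxE.
by case: a => [[|[|[|[|//]]]] ?] /=; rewrite gez0_abs //; congr (w _ _); exact: val_inj.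
Qed.

Lemma wt4_coords i j k l :
  [/\ wt4 i j k l 0 0 = i%:Z, wt4 i j k l 0 1 = j%:Z, wt4 i j k l 0 2 = k%:Z
    & wt4 i j k l 0 ord_max = l%:Z].
Proof. by split; rewrite mxE. Qed.

Lemma wt4_inj i j k l i' j' k' l' : wt4 i j k l = wt4 i' j' k' l' ->
  [/\ i = i', j = j', k = k' & l = l'].
Proof.
move=> e; have [a1 a2 a3 a4] := wt4_coords i j k l.
have [b1 b2 b3 b4] := wt4_coords i' j' k' l'; rewrite e in a1 a2 a3 a4.
by split; apply/eqP; rewrite -eqz_nat -?a1 -?a2 -?a3 -?a4 ?b1 ?b2 ?b3 ?b4.
Qed.

Lemma boxes_wt4 p i j k l : boxes p (wt4 i j k l) <-> le_inf (Some l.+1) (p i j k).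
Proof.
split=> [[i' [j' [k' [l' [/wt4_inj [-> -> -> ->]]]]]] //|h].
by exists i, j, k, l.
Qed.

Lemma boxes_ge0 p w : boxes p w -> forall a, 0 <= w 0 a.
Proof. by move=> [i [j [k [l [-> _]]]]] a; rewrite mxE. Qed.

(** An entry is determined by the heights [l] of the boxes above it; the height [l = m] tells a
    finite entry [m] from [None]. *)
Lemma boxes_inj : injective boxes.
Proof.
move=> p p' e; apply/funext => i; apply/funext => j; apply/funext => k.
have {}e l : le_inf (Some l.+1) (p i j k) <-> le_inf (Some l.+1) (p' i j k).
  by rewrite -!boxes_wt4 e.
case: (p i j k) (p' i j k) e => [m|] [m'|] //= e.
- congr Some; apply/eqP; rewrite eqn_leq; apply/andP; split.
    by case: m e => // m e; apply/e.
  by case: m' e => // m' e; apply/e.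
- by have := (e m).2 isT; rewrite ltnn.
- by have := (e m').1 isT; rewrite ltnn.
Qed.

Section SolidPartition.
Variable p : solid.
Hypothesis p_solid : is_solid_partition p.

Lemma le_inf_trans a b c : le_inf a b -> le_inf b c -> le_inf a c.
Proof. by case: a b c => [a|] [b|] [c|] //=; exact: leq_trans. Qed.

Lemma le_inf_refl a : le_inf a a.
Proof. by case: a => /=. Qed.

Lemma solid_monotone i j k i' j' k' : (i' <= i)%N -> (j' <= j)%N -> (k' <= k)%N ->
  le_inf (p i j k) (p i' j' k').
Proof.
move=> ii jj kk.
apply: (@le_inf_trans _ (p i' j k)).
  rewrite -(subnK ii); elim: (i - i')%N => [|n IH]; first exact: le_inf_refl.
  by apply: le_inf_trans IH; have [] := p_solid (n + i') j k.
apply: (@le_inf_trans _ (p i' j' k)).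
  rewrite -(subnK jj); elim: (j - j')%N => [|n IH]; first exact: le_inf_refl.
  by apply: le_inf_trans IH; have [] := p_solid i' (n + j') k.
rewrite -(subnK kk); elim: (k - k')%N => [|n IH]; first exact: le_inf_refl.
by apply: le_inf_trans IH; have [] := p_solid i' j' (n + k').
Qed.

Lemma boxes_down (w w' : weight) : boxes p w -> (forall a, 0 <= w' 0 a <= w 0 a) -> boxes p w'.
Proof.
move=> [i [j [k [l [wE h]]]]] w'w.
have [i' [j' [k' [l' E]]]] : exists i' j' k' l', w' = wt4 i' j' k' l'.
  by apply: ge0_wt4 => a; case/andP: (w'w a).
have {wE} wE : w = wt4 i j k l by [].
rewrite E; apply/boxes_wt4.
have [a1 a2 a3 a4] := wt4_coords i j k l.
have [b1 b2 b3 b4] := wt4_coords i' j' k' l'.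
have := w'w 0; have := w'w 1; have := w'w 2; have := w'w ord_max.
rewrite wE E a1 a2 a3 a4 b1 b2 b3 b4 !lez_nat.
move=> /andP[_ ll] /andP[_ kk] /andP[_ jj] /andP[_ ii].
apply: (le_inf_trans _ (solid_monotone ii jj kk)).
by apply: (le_inf_trans _ h); rewrite /= ltnS.
Qed.

End SolidPartition.

(** * DT and PT vertices with legs in [x_4 = 0] *)

Section Vertices.
Variable P : 'I_4 -> pfun.
Hypothesis P_line : forall a, is_line_partition (P a).
Hypothesis P_max : P ord_max = empty_pp.

Lemma pi_CM_x4 w : pi_CM P w -> w 0 ord_max = 0.
Proof.
have [M M0 PM] := line_partitions_bounded P_line.
by move=> [a [/(ext_leg_coords P_line P_max M0 PM) []]].
Qed.

Lemma x4_free_section b a : x4_free b (section_seq P a).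
Proof.
apply/implyP => _; rewrite /section_seq all_map; apply/allP => w.
rewrite in_fset_set; last exact: finite_section.
by rewrite inE => -[wa _] /=; rewrite pi_CM_x4 //; exists a.
Qed.

Lemma section_seq_max : section_seq P ord_max = [::].
Proof.
rewrite /section_seq (_ : [set w | _] = set0) ?fset_set0 // -subset0.
by move=> w [[[x [y [z [_ _ _]]]]]]; rewrite P_max ltn0.
Qed.

Lemma x4_free_defect S : pi_CM P `<=` S -> finite_set (S `\` pi_CM P) ->
  in_x4_zero S -> x4_free true (defect_seq P S).
Proof.
move=> CM_S S_fin S4; apply/implyP => _; rewrite /defect_seq all_map.
apply/allP => w; rewrite in_fset_set; last exact: finite_defect.
rewrite inE /defect_support /= => dw; apply/eqP; apply: S4; apply: contrapT => wS.
by move: dw; rewrite defect_out ?ind0 ?eqxx //; move/CM_S.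
Qed.

Section DT.
Variable p : solid.
Hypothesis p_DT : Pi_DT P p.

Let p_solid : is_solid_partition p. Proof. by case: p_DT. Qed.
Let CM_p : pi_CM P `<=` boxes p. Proof. by case: p_DT. Qed.
Let p_fin : finite_set (boxes p `\` pi_CM P). Proof. by case: p_DT. Qed.

Lemma leg_decomposition_DT (t : 'I_4 -> ratfun 5) :
  (forall i, t i != 0) -> (forall i, 1 - t i != 0) ->
  leg_decomposition P (fun t => Z_DT t p) (defect_seq P (boxes p)) t.
Proof. by move=> t0 s0; exact: gen_fun_defect. Qed.

(** Such a box lies in no leg: there [x_4] is [0], so its other coordinates would be [-1]. *)
Lemma trivial_box_defect (w : weight) :
  (forall i : 'I_3, w 0 (lift ord_max i) = w 0 ord_max - 1) ->
  defect P (boxes p) w = ind (boxes p) w.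
Proof.
move=> wE; have [pw|pw] := pselect (boxes p w); apply: defect_out => //; last first.
  by move/CM_p.
move=> /pi_CM_x4 w3; have := boxes_ge0 pw (lift ord_max 0).
by rewrite wE w3.
Qed.

Lemma supported_trivial_y_coef : supported_DT p ->
  trivial_y_coef (defect_seq P (boxes p)) = 0.
Proof.
move=> p4; rewrite /trivial_y_coef big_map big1 // => w /= /forallP wE.
have {}wE (i : 'I_3) : w 0 (lift ord_max i) = w 0 ord_max - 1 by apply/eqP.
rewrite trivial_box_defect // ind0 // => pw.
by have := boxes_ge0 pw (lift ord_max 0); rewrite wE (p4 _ pw).
Qed.

Lemma unsupported_trivial_y_coef : ~ supported_DT p ->
  0 < trivial_y_coef (defect_seq P (boxes p)).
Proof.
move=> p4; have [w pw w3] : exists2 w, boxes p w & w 0 ord_max != 0.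
  apply: contrapT => h; apply: p4 => w pw; apply/eqP; apply: contrapT => w3.
  by apply: h; exists w => //; apply/negP.
(* The weight giving [y / t_4] that lies below every box with [x_4 > 0]. *)
pose e := wt4 0 0 0 1.
have [e0 e1 e2 e3] := wt4_coords 0 0 0 1.
have eE (i : 'I_3) : e 0 (lift ord_max i) = e 0 ord_max - 1.
  by rewrite !mxE; case: i => [[|[|[|//]]] ?].
have pe : boxes p e.
  apply: (boxes_down p_solid pw) => a; rewrite mxE.
  have := boxes_ge0 pw.
  case: a => [[|[|[|[|//]]]] h] /= w0; rewrite ?w0 //.
  move: w3 (w0 ord_max); rewrite (_ : Ordinal h = ord_max); last exact: val_inj.
  by move: (w 0 ord_max) => c; clear; lia.
have de : e \in fset_set (defect_support P (boxes p)).
  rewrite in_fset_set; last exact: finite_defect.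
  by rewrite inE /defect_support /= trivial_box_defect // ind1.
rewrite /trivial_y_coef big_map big_mkcond (big_fsetD1 e) //=.
have -> : [forall i : 'I_3, e 0 (lift ord_max i) == e 0 ord_max - 1].
  by apply/forallP => i; rewrite eE.
(* The other weights of this shape contribute indicators, so nothing cancels the [1] coming from
   [e]. *)
rewrite trivial_box_defect // ind1 // ltr_pwDl // sumr_ge0 // => v _.
case: ifP => // /forallP vE.
by rewrite trivial_box_defect // => i; apply/eqP.
Qed.

Lemma vertex_DT_unsupported : ~ supported_DT p ->
  specializes y_eq_t4 (bracket4 (- v_tilde P (fun t => Z_DT t p))) 0.
Proof.
move=> p4; apply: (@bracket4_specializes0 _ _ false (defect_seq P (boxes p)) (section_seq P)).
- exact: leg_decomposition_DT tvar_neq0 tvar_sub_neq0.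
- exact: leg_decomposition_DT tinv_neq0 tinv_sub_neq0.
- by move=> a t; exact: Z_leg_section.
- by move=> a; exact: x4_free_section.
- exact: section_seq_max.
- by [].
- exact: unsupported_trivial_y_coef.
Qed.

Lemma vertex_DT_supported : supported_DT p ->
  specializes y_eq_t4 (bracket4 (- v_tilde P (fun t => Z_DT t p)))
    (bracket3 (- V3D P (fun t => Z_DT t p))).
Proof.
move=> p4; apply: (@bracket4_specializes _ _ true (defect_seq P (boxes p)) (section_seq P)).
- exact: leg_decomposition_DT tvar_neq0 tvar_sub_neq0.
- exact: leg_decomposition_DT tinv_neq0 tinv_sub_neq0.
- by move=> a t; exact: Z_leg_section.
- by move=> a; exact: x4_free_section.
- exact: section_seq_max.
- exact: x4_free_defect.
- by [].
- exact: supported_trivial_y_coef.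
Qed.

End DT.

Section PT.
Variable B : {fset weight}.
Hypothesis B_PT : Pi_PT P B.

Lemma PT_ext_leg w : w \in B -> exists a, ext_leg P a w.
Proof.
move=> /(B_PT.1 w) [|[]//]; rewrite /II_ /= => w2.
have [a [wa _]] : pi_CM P w by apply/nlegs_gt0; rewrite w2.
by exists a.
Qed.

Lemma PT_x4 w : w \in B -> w 0 ord_max = 0.
Proof.
have [M M0 PM] := line_partitions_bounded P_line.
by move=> /PT_ext_leg [a /(ext_leg_coords P_line P_max M0 PM) []].
Qed.

Lemma PT_supported : supported_PT P B.
Proof. by split=> w; [exact: pi_CM_x4 | exact: PT_x4]. Qed.

Let CM_fin : finite_set (pi_CM P `\` pi_CM P).
Proof. by rewrite setDv. Qed.

Definition PT_seq : lseq 4 :=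
  defect_seq P (pi_CM P) ++ [seq (1, w) | w <- B].

Lemma leg_decomposition_PT (t : 'I_4 -> ratfun 5) :
  (forall i, t i != 0) -> (forall i, 1 - t i != 0) ->
  leg_decomposition P (fun t => Z_PT t P B) PT_seq t.
Proof.
move=> t0 s0; rewrite /leg_decomposition /Z_PT.
rewrite (gen_fun_defect P_line P_max (fun w h => h) CM_fin t0 s0).
rewrite lev_cat addrAC; congr (_ + _ + _).
by rewrite /lev big_map; apply: eq_bigr => w _; rewrite mul1r.
Qed.

Lemma x4_free_PT : x4_free true PT_seq.
Proof.
apply: x4_free_cat; first by apply: x4_free_defect => // w; exact: pi_CM_x4.
by apply/implyP => _; rewrite all_map; apply/allP => w /PT_x4 /= ->.
Qed.

(** As [x_4] is [0] on an extended leg, the first three coordinates would all be [-1], but only the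
    one along the leg may be negative. *)
Lemma trivial_not_ext_leg a (w : weight) : ext_leg P a w ->
  ~ forall i : 'I_3, w 0 (lift ord_max i) = w 0 ord_max - 1.
Proof.
have [M M0 PM] := line_partitions_bounded P_line.
move=> /(ext_leg_coords P_line P_max M0 PM) [_ w3 w_ge0] wE.
have [i ia] : exists i : 'I_3, lift ord_max i != a.
  have [e|e] := eqVneq (lift ord_max (0 : 'I_3)) a; last by exists 0.
  by exists 1; rewrite -e (inj_eq lift_inj).
by have := w_ge0 _ ia; rewrite wE w3.
Qed.

Lemma PT_trivial_y_coef : trivial_y_coef PT_seq = 0.
Proof.
rewrite /trivial_y_coef big_cat !big_map /=.
rewrite [X in X + _]big1_seq ?add0r => [|w /andP[/forallP wE]].
  apply: big1_seq => w /andP[/forallP wE].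
  by move=> /PT_ext_leg [a /trivial_not_ext_leg[]] i; exact/eqP.
rewrite in_fset_set; last exact: finite_defect.
have wCM : ~ pi_CM P w.
  by move=> [a [/trivial_not_ext_leg wN _]]; apply: wN => i; exact/eqP.
by rewrite inE /defect_support /= defect_out // ind0 // eqxx.
Qed.

Lemma vertex_PT :
  specializes y_eq_t4 (bracket4 (- v_tilde P (fun t => Z_PT t P B)))
    (bracket3 (- V3D P (fun t => Z_PT t P B))).
Proof.
apply: (@bracket4_specializes _ _ true PT_seq (section_seq P)).
- exact: leg_decomposition_PT tvar_neq0 tvar_sub_neq0.
- exact: leg_decomposition_PT tinv_neq0 tinv_sub_neq0.
- by move=> a t; exact: Z_leg_section.
- by move=> a; exact: x4_free_section.
- exact: section_seq_max.
- exact: x4_free_PT.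
- by [].
- exact: PT_trivial_y_coef.
Qed.

End PT.

(** * Finiteness at each order in [q] *)

Lemma vol_DTE p : Pi_DT P p ->
  vol_DT P p = renorm_vol P (pi_CM P) + (nembedded P p)%:Z.
Proof. by move=> [_ CM_p p_fin]; exact: renorm_volE. Qed.

Lemma coord_shift (w : weight) a b (s : int) :
  (w + s *: e_ a) 0 b = w 0 b + (if b == a then s else 0).
Proof. by rewrite mxE [X in _ + X]mxE e_E; case: (b == a); rewrite ?mulr1 ?mulr0. Qed.

(** Bounds how far a finite configuration reaches along an axis: [sg = -1] serves for embedded
    boxes, [sg = 1] for negative coordinates in PT configurations. *)
Lemma translates_leq_card (X : {fset weight}) (w : weight) a (sg : int) (n : nat) :
  sg != 0 -> (forall s, (s < n)%N -> w + (sg * s%:Z) *: e_ a \in X) ->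
  (n <= #|` X|)%N.
Proof.
move=> sg0 wX; pose l := [seq w + (sg * s%:Z) *: e_ a | s <- iota 0 n].
have <- : size l = n by rewrite size_map size_iota.
apply: uniq_leq_size.
  rewrite map_inj_uniq ?iota_uniq // => s s' /(congr1 (fun v : weight => v 0 a)).
  by rewrite !coord_shift eqxx => /addrI /(mulfI sg0) [].
by move=> _ /mapP[s + ->]; rewrite mem_iota add0n => /= /wX.
Qed.

(** If [w] had [a]-th coordinate at least [M + c + 1], going down [c] steps along [a] would give
    [c + 1] boxes with that coordinate at least [M]. Only leg [a] could contain one of them, and it
    would then contain [w]. So all are embedded, which is one too many. *)
Lemma embedded_cube M p c : (0 < M)%N ->
  (forall a x y, (0 < P a x y)%N -> (x < M)%N /\ (y < M)%N) ->
  Pi_DT P p -> nembedded P p = c -> boxes p `\` pi_CM P `<=` cube (M + c).+1.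
Proof.
move=> M0 PM [p_solid CM_p p_fin] pc w [pw wCM] a.
have w_ge0 := boxes_ge0 pw.
suff wa : w 0 a < (M + c)%:Z + 1.
  by move: (w_ge0 a) wa; move: (w 0 a) => x; clear; lia.
rewrite ltNge; apply/negP => wa.
suff : (c.+1 <= nembedded P p)%N by rewrite pc ltnn.
apply: (@translates_leq_card _ w a (-1)) => // s sc.
have wE b : (w + (-1 * s%:Z) *: e_ a) 0 b = if b == a then w 0 a - s%:Z else w 0 b.
  by rewrite coord_shift mulN1r; case: eqP => [->|]; rewrite ?addr0.
have sM : M%:Z <= w 0 a - s%:Z.
  by move: wa sc; move: (w 0 a) => x; clear; lia.
rewrite in_fset_set // inE; split.
  apply: (boxes_down p_solid pw) => b; rewrite wE.
  case: eqP => [->|_]; last by rewrite w_ge0 lexx.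
  by move: sM; move: (w 0 a) => x; clear; lia.
move=> [b [bw b_ge0]].
have [ab|ab] := eqVneq a b.
  apply: wCM; exists b; split; last exact: w_ge0.
  by apply: ext_leg_shift bw _ => i; rewrite wE ab => /negbTE ->.
have [_ _ /(_ a ab)] := ext_leg_coords P_line P_max M0 PM bw.
by rewrite wE eqxx; move: sM; move: (w 0 a) => x; clear; lia.
Qed.

(** The order fixes the number of embedded boxes, these lie in a fixed cube, and they determine
    [p]. *)
Lemma finite_DT_order n : finite_set [set p | Pi_DT P p /\ vol_DT P p = n].
Proof.
have [M M0 PM] := line_partitions_bounded P_line.
pose c := absz (n - renorm_vol P (pi_CM P)).
apply: (@finite_set_inj_on _ _ (fun p => fset_set (boxes p `\` pi_CM P)) _
  [set X : {fset weight} | forall w, w \in X -> cube (M + c).+1 w]).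
- exact/finite_subsets/finite_cube.
- move=> p [p_DT pn] w; rewrite in_fset_set; last by case: p_DT.
  rewrite inE; apply: (embedded_cube M0 PM p_DT).
  by move: pn; rewrite vol_DTE // /c; move: (renorm_vol _ _) => x; clear; lia.
- move=> p p' [[_ CM_p p_fin] _] [[_ CM_p' p_fin'] _] /(congr1 (fun X : {fset weight} => [set` X])).
  rewrite !fset_setK // => e; apply: boxes_inj.
  by rewrite -(setDUK CM_p) -(setDUK CM_p') e.
Qed.

(** If the coordinate of [w] along its leg is negative, moving up along the leg stays in [I_minus]
    as long as that coordinate is negative. Closure under such moves puts all these weights in [B],
    so the absolute value is at most the cardinality of [B]. *)
Lemma PT_cube M (B : {fset weight}) c : (0 < M)%N ->
  (forall a x y, (0 < P a x y)%N -> (x < M)%N /\ (y < M)%N) ->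
  Pi_PT P B -> #|` B| = c -> forall w, w \in B -> cube (M + c) w.
Proof.
move=> M0 PM B_PT Bc w wB.
have [w2|[[a wa] w_neg]] := B_PT.1 _ wB.
  have := nlegs_gt1_cube P_line P_max M0 PM (w := w); rewrite w2 => /(_ isT) wM i.
  by have := wM i; move: (w 0 i) => x; clear; lia.
have [_ _ w_ge0] := ext_leg_coords P_line P_max M0 PM wa.
have {w_neg} wa_neg : w 0 a < 0.
  have [b wb] := w_neg; have [<-//|/w_ge0/andP[]] := eqVneq b a.
  by rewrite leNgt wb.
suff wac : (absz (w 0%R a) <= c)%N.
  move=> i; have [->|/w_ge0] := eqVneq i a.
    by move: wac wa_neg; move: (w 0 a) => x; clear; lia.
  by move: (w 0 i) => x; clear; lia.
rewrite -Bc; apply: (@translates_leq_card _ w a 1) => //.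
elim=> [_|s IH sa]; first by rewrite mulr0 scale0r addr0.
apply: (B_PT.2 _ a); last first.
  suff -> : w + (1 * s.+1%:Z) *: e_ a - e_ a = w + (1 * s%:Z) *: e_ a.
    by apply: IH; exact: ltnW.
  by rewrite !mul1r intS scalerDl scale1r addrA addrAC addrK.
right; split.
  exists a; apply: ext_leg_shift wa _ => i ia.
  by rewrite coord_shift (negbTE ia) addr0.
exists a; rewrite coord_shift eqxx.
by move: sa wa_neg; move: (w 0 a) => x; clear; lia.
Qed.

Lemma finite_PT_order n : finite_set [set B | Pi_PT P B /\ vol_PT P B = n].
Proof.
have [M M0 PM] := line_partitions_bounded P_line.
pose c := absz (n - renorm_vol P (pi_CM P)).
apply: sub_finite_set (finite_subsets (finite_cube (M + c))) => B [B_PT Bn] w.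
apply: (PT_cube M0 PM B_PT).
by move: Bn; rewrite /vol_PT /c; move: (renorm_vol _ _) => x; clear; lia.
Qed.

End Vertices.

(** * Vertex series *)

Lemma sign_oddz (K : fieldType) (n : int) : (-1 : K) ^+ odd (absz n) = (-1) ^ n.
Proof.
case: n => n; first by rewrite signr_odd.
by rewrite NegzE abszN signr_odd -exprnN -exprVn invrN invr1.
Qed.

Section VertexSeries.
Variable P : 'I_4 -> pfun.
Hypothesis P_line : forall a, is_line_partition (P a).
Hypothesis P_max : P ord_max = empty_pp.

(** Signs matter only on supported [p], as the other terms specialize to [0] with either sign. By
    [vol_DTE] the exponent of the prescribed sign is the order in [q]. *)
Lemma V_DT_specializes (sgn : solid -> bool) :
  (forall p, Pi_DT P p -> supported_DT p -> sgn p = sign_DT P p) ->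
  specializes_series (V_DT P sgn) (qneg (fun n =>
    \sum_(p \in [set p | [/\ Pi_DT P p, supported_DT p & vol_DT P p = n]])
      bracket3 (- V3D P (fun t => Z_DT t p)))).
Proof.
move=> sgnE n; rewrite /V_DT /qneg /=.
set A := [set p | Pi_DT P p /\ vol_DT P p = n].
have fA : finite_set A by exact: finite_DT_order.
have -> : [set p | [/\ Pi_DT P p, supported_DT p & vol_DT P p = n]]
    = A `&` [set p | supported_DT p].
  by apply/seteqP; split=> p /=; [case=> ? ? ?|case=> -[? ?] ?].
rewrite [X in _ * X]fsbig_mkcondr !fsbig_finite // mulr_sumr.
apply: specializes_sum => p; rewrite in_fset_set // inE => -[p_DT pn].
case: ifPn => [|]; rewrite ?notin_setE ?inE /= => p4; last first.
  rewrite mulr0 -(mulr0 ((-1) ^+ sgn p)); apply: specializes_sign.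
  exact: vertex_DT_unsupported.
rewrite -sign_oddz -pn vol_DTE // -/(sign_DT P p) -sgnE //.
exact/specializes_sign/vertex_DT_supported.
Qed.

Lemma V_PT_specializes (sgn : {fset weight} -> bool) :
  (forall B, Pi_PT P B -> supported_PT P B -> sgn B = sign_PT P B) ->
  specializes_series (V_PT P sgn) (qneg (fun n =>
    \sum_(B \in [set B | Pi_PT P B /\ vol_PT P B = n])
      bracket3 (- V3D P (fun t => Z_PT t P B)))).
Proof.
move=> sgnE n; rewrite /V_PT /qneg /=.
set A := [set B | Pi_PT P B /\ vol_PT P B = n].
have fA : finite_set A by exact: finite_PT_order.
rewrite !fsbig_finite // mulr_sumr.
apply: specializes_sum => B; rewrite in_fset_set // inE => -[B_PT Bn].
rewrite -sign_oddz -Bn /vol_PT addrC -/(sign_PT P B) -sgnE //; last first.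
  exact: PT_supported.
exact/specializes_sign/vertex_PT.
Qed.

(** The order exceeds the volume of [pi_CM] by a number of boxes. Such lower bounds make the product
    of two vertex series a finite sum at each order. *)
Lemma V_DT_low sgn n : n < renorm_vol P (pi_CM P) -> V_DT P sgn n = 0.
Proof.
move=> n_lt; apply: fsbig1 => p [p_DT pn]; move: n_lt.
by rewrite -pn vol_DTE //; move: (renorm_vol _ _) => x; clear; lia.
Qed.

Lemma V_PT_low sgn n : n < renorm_vol P (pi_CM P) -> V_PT P sgn n = 0.
Proof.
move=> n_lt; apply: fsbig1 => B [B_PT Bn]; move: n_lt.
by rewrite -Bn /vol_PT; move: (renorm_vol _ _) => x; clear; lia.
Qed.

End VertexSeries.

(** * Products of Laurent series and their specialization *)

Definition int_range (a b : int) : {fset int} :=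
  seq_fset tt [seq a + i%:Z | i <- iota 0 (absz (b - a)).+1].

Lemma mem_int_range a b k : a <= k -> k <= b -> k \in int_range a b.
Proof.
move=> ak kb; rewrite seq_fsetE; apply/mapP; exists (absz (k - a)).
  by rewrite mem_iota add0n /=; move: ak kb; clear; lia.
by move: ak; clear; lia.
Qed.

Lemma qmul_range (K : fieldType) (f g : qseries K) (a b : int) n :
  (forall k, k < a -> f k = 0) -> (forall k, k < b -> g k = 0) ->
  qmul f g n = \sum_(k <- int_range a (n - b)) f k * g (n - k).
Proof.
move=> f0 g0; rewrite /qmul; apply: fsbigTE => k kN.
have [ka|ak] := ltP k a; first by rewrite f0 ?mul0r.
have [kb|bk] := leP k (n - b); first by rewrite mem_int_range in kN.
by rewrite g0 ?mulr0 //; move: bk; clear; lia.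
Qed.

Lemma qneg_low (K : fieldType) (f : qseries K) n : qneg f n = 0 -> f n = 0.
Proof. by move/eqP; rewrite mulf_eq0 expfz_eq0 oppr_eq0 oner_eq0 andbF => /eqP. Qed.

(** Transfers lower bounds on orders from 4-fold to 3-fold series, since [0] specializes only to
    [0]. *)
Lemma specializes_low (f : qseries (ratfun 4)) g n :
  specializes_series f (qneg g) -> f n = 0 -> g n = 0.
Proof.
move=> /(_ n) fg f0; rewrite f0 in fg.
by apply/qneg_low/(specializes_unique fg)/specializes0.
Qed.

Lemma qmul_specializes (f g : qseries (ratfun 4)) (f' g' : qseries (ratfun 3))
    (a b : int) :
  (forall k, k < a -> f k = 0) -> (forall k, k < b -> g k = 0) ->
  specializes_series f (qneg f') -> specializes_series g (qneg g') ->
  specializes_series (qmul f g) (qneg (qmul f' g')).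
Proof.
move=> f0 g0 ff' gg' n; rewrite /qneg (qmul_range _ f0 g0).
rewrite (@qmul_range _ _ _ a b); first last.
- by move=> k /g0; exact: specializes_low.
- by move=> k /f0; exact: specializes_low.
rewrite mulr_sumr; apply: specializes_sum => k _.
(* The substitution [q |-> -q] is multiplicative: [n = k + (n - k)]. *)
have -> : (-1) ^ n * (f' k * g' (n - k)) = qneg f' k * qneg g' (n - k).
  by rewrite /qneg mulrACA -expfzDr ?oppr_eq0 ?oner_eq0 // addrCA subrr addr0.
exact: specializesM.
Qed.

Lemma is_line_partition_empty : is_line_partition empty_pp.
Proof.
split=> //; split=> //; rewrite (_ : [set _ | _] = set0) //.
by rewrite -subset0 => ij.
Qed.

Lemma is_line_partition_quad lam mu nu : is_line_partition lam ->
  is_line_partition mu -> is_line_partition nu ->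
  forall a, is_line_partition (quad lam mu nu empty_pp a).
Proof.
move=> hl hm hn [[|[|[|[|//]]]] ?] //; exact: is_line_partition_empty.
Qed.

Lemma quad_empty : quad empty_pp empty_pp empty_pp empty_pp = empty4.
Proof. by apply/funext => -[[|[|[|[|//]]]] ?]. Qed.

Lemma at_most_two_quad lam mu :
  at_most_two_nonempty (quad lam mu empty_pp empty_pp).
Proof.
rewrite /at_most_two_nonempty.
apply: (@leq_trans #|[set (0 : 'I_4); 1]%SET|); last by rewrite cards2.
apply/subset_leq_card/fintype.subsetP => -[[|[|[|[|//]]]] h]; rewrite !inE //=.
- by rewrite /quad /= eqxx.
- by rewrite /quad /= eqxx.
Qed.

Theorem theorem1p8 (lam mu nu : pfun)
  (hlam : is_line_partition lam) (hmu : is_line_partition mu)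
  (hnu : is_line_partition nu) :
  [/\ specializes_series
        (V_DT (quad lam mu nu empty_pp) (sign_DT (quad lam mu nu empty_pp)))
        (qneg (V3D_DT lam mu nu)),
      specializes_series
        (V_PT (quad lam mu empty_pp empty_pp)
              (sign_PT (quad lam mu empty_pp empty_pp)))
        (qneg (V3D_PT lam mu)) &
      DTPT_correspondence -> sign_compatibility ->
      V3D_DT lam mu empty_pp
      = qmul (V3D_PT lam mu) (V3D_DT empty_pp empty_pp empty_pp)].
Proof.
have he := is_line_partition_empty.
have line3 := is_line_partition_quad hlam hmu hnu.
have line2 := is_line_partition_quad hlam hmu he.
have line0 := is_line_partition_quad he he he.
split; first exact: V_DT_specializes.
  exact: V_PT_specializes.
move=> _ /(_ (quad lam mu empty_pp empty_pp)) [].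
- by move=> a; have [] := line2 a.
- exact: at_most_two_quad.
move=> sD [sP [s0 [real sDE sPE]]]; rewrite -quad_empty => s0E.
(* The compatible signs agree with the prescribed ones on supported fixed points, which is all that
   the specialization sees. *)
have DT := V_DT_specializes line2 erefl sDE.
have PT := V_PT_specializes line2 erefl sPE.
have DT0 := V_DT_specializes line0 erefl s0E.
have low0 := V_DT_low line0 erefl s0.
have prod := qmul_specializes (V_PT_low sP) (fun k => low0 k) PT DT0.
apply/funext => n.
have := real n; rewrite /agree_at_order -quad_empty => realn.
(* Both sides specialize the same 4-fold coefficient, so they agree up to the common factor
   [(-1) ^ n], which is then cancelled. *)
have := prod n; rewrite -realn => /(specializes_unique (DT n)).
by apply: mulfI; rewrite expfz_neq0 // oppr_eq0 oner_eq0.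
Qed.
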